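(* Let $d\ge 3$ and let $\mu$ be the measure on $\mathbb{R}^d$ which is the sum of the one-dimensional Lebesgue (arc length) measure on the segment $[0,1]\times\{0\}^{d-1}$ and the $(d-1)$-dimensional Lebesgue (area) measure on $\{0\}\times[0,1]^{d-1}$. Then $L^2(\mu)$ admits a Fourier frame. In particular, there is a measure on $\mathbb{R}^d$ which is the sum of the arc length measure on a curve and the area measure on a hypersurface and whose $L^2$ space admits a Fourier frame.
   Context: For $\lambda\in\mathbb{R}^d$ let $e_\lambda(x)=e^{2\pi i\langle\lambda,x\rangle}$. For a positive finite Borel measure $\mu$ on $\mathbb{R}^d$ and a countable set $\Lambda\subset\mathbb{R}^d$, the system $E(\Lambda)=\{e_\lambda\}_{\lambda\in\Lambda}$ is a Fourier frame for $L^2(\mu)$ if there are constants $0<A,B<\infty$ with $A\|f\|^2_{L^2(\mu)}\le\sum_{\lambda\in\Lambda}|\langle f,e_\lambda\rangle_{L^2(\mu)}|^2\le B\|f\|^2_{L^2(\mu)}$ for all $f\in L^2(\mu)$. ''$L^2(\mu)$ admits a Fourier frame'' means such a $\Lambda$ exists. *)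

(* Defs.v *)
From HB Require Import structures.
From mathcomp Require Import all_boot all_order all_algebra.
From mathcomp Require Import all_classical all_reals all_analysis.
Set Implicit Arguments. Unset Strict Implicit. Unset Printing Implicit Defensive.
Import Order.TTheory GRing.Theory Num.Theory.
Import numFieldNormedType.Exports.
Local Open Scope classical_set_scope.
Local Open Scope ring_scope.

Section Defs.
Variable R : realType.

(* Integral of a nonnegative function g over the unit cube [0,1]^n w.r.t.
   n-dimensional Lebesgue measure, written as an iterated integral
   (equal to the product-measure integral by Tonelli, for measurable g). *)
Fixpoint cube_int (n : nat) : (n.-tuple R -> \bar R) -> \bar R :=
  match n return (n.-tuple R -> \bar R) -> \bar R with
  | 0%N => fun g => g [tuple]
  | n'.+1 => fun g =>
      (\int[lebesgue_measure]_(t in `[0%R, 1%R]) cube_int (fun y => g [tuple of t :: y]))%E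
  end.

Definition seg_pt (d : nat) (t : R) : d.-tuple R :=
  [tuple (if val i == 0%N then t else 0) | i < d].

Definition face_pt (d : nat) (y : d.-1.-tuple R) : d.-tuple R :=
  [tuple (if val i == 0%N then 0 else nth 0 (tval y) (val i).-1) | i < d].

Definition mu_nnint (d : nat) (g : d.-tuple R -> \bar R) : \bar R :=
  ((\int[lebesgue_measure]_(t in `[0%R, 1%R]) g (seg_pt d t))
   + @cube_int d.-1 (fun y => g (@face_pt d y)))%E.

Definition mu_int (d : nat) (h : d.-tuple R -> R) : R :=
  fine (mu_nnint (fun x => (Num.max (h x) 0)%:E)
        - mu_nnint (fun x => (Num.max (- h x) 0)%:E))%E.

(* A complex-valued function f = u + i v on R^d is in L^2(mu). *)
Definition in_L2mu (d : nat) (u v : d.-tuple R -> R) : Prop :=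
  measurable_fun [set: d.-tuple R] u /\ measurable_fun [set: d.-tuple R] v /\
  (mu_nnint (fun x => (u x ^+ 2 + v x ^+ 2)%:E) < +oo)%E.

Definition L2mu_norm2 (d : nat) (u v : d.-tuple R -> R) : \bar R :=
  mu_nnint (fun x => (u x ^+ 2 + v x ^+ 2)%:E).

Definition dotR (d : nat) (a x : d.-tuple R) : R :=
  \sum_(i < d) tnth a i * tnth x i.

(* |<f, e_lam>_{L^2(mu)}|^2 where e_lam(x) = exp(2 pi i <lam, x>) and
   f = u + i v:  <f,e_lam> = int (u + i v)(cos th - i sin th) dmu,
   th = 2 pi <lam, x>. *)
Definition fourier_coef2 (d : nat) (u v : d.-tuple R -> R) (lam : d.-tuple R) : R :=
  let th := fun x => 2 * pi * dotR lam x in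
  let re := mu_int (fun x => u x * cos (th x) + v x * sin (th x)) in
  let im := mu_int (fun x => v x * cos (th x) - u x * sin (th x)) in
  re ^+ 2 + im ^+ 2.

Definition is_fourier_frame_mu (d : nat) (Lam : set (d.-tuple R)) : Prop :=
  countable Lam /\
  exists A B : R, 0 < A /\ 0 < B /\
    forall u v : d.-tuple R -> R, in_L2mu u v ->
      ((A%:E * L2mu_norm2 u v
          <= \esum_(lam in Lam) (fourier_coef2 u v lam)%:E)
       /\ (\esum_(lam in Lam) (fourier_coef2 u v lam)%:E
          <= B%:E * L2mu_norm2 u v))%E.

End Defs.

(* Main.v *)
(** The coefficient of [f] at [(a, b)] in [Z x Z^(d-1)] is [z1 a + z2 b], where
    [z1], [z2] are the Fourier coefficients of the restrictions of [f] to the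
    segment and to the face; both families are Parseval.  Taking all pairs
    [(a, b)] fails, and a bijection [a -> b] may produce cancellation.  Instead
    enumerate both index sets by [nat] and let the frequencies be the edges of
    a forest with vertices [nat + nat] in which every vertex has three children on
    the opposite side.  Since [|z|^2 <= 2|z + w|^2 + 2|w|^2] and every vertex is
    a parent three times but a child at most once, the edge sum of
    [|z1 a + z2 b|^2] controls the sum of all [|z1|^2] and [|z2|^2].

    Parseval on the cube: the [L2]-closure of the trigonometric polynomials is
    closed under products of bounded functions and dominated limits, so the sets
    whose indicator lies in it form a sigma-algebra; it contains the half-spaces
    [y_i < a], because on (0,1) that condition reads
    [0 < sin (pi y_i) * sin (pi (a - y_i))]. *)

Require Import Defs.
From HB Require Import structures.
From mathcomp Require Import all_boot all_order all_algebra.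
From mathcomp Require Import all_classical all_reals all_analysis.
From mathcomp Require Import measurable_realfun ring lra.

Set Implicit Arguments. Unset Strict Implicit. Unset Printing Implicit Defensive.
Import Order.TTheory GRing.Theory Num.Theory.
Import numFieldNormedType.Exports.
Local Open Scope classical_set_scope.
Local Open Scope ring_scope.

(** * Square-integrable functions *)

Section L2.
Context d (T : measurableType d) (R : realType).
Variable nu : {finite_measure set T -> \bar R}.
Implicit Types f g h p q : T -> R.

(** Kept as an extended real and never rooted: every estimate below concerns squared norms, with
    $(a+b)^2\le 2a^2+2b^2$ in place of the triangle inequality. *)
Definition sqnorm f : \bar R := (\int[nu]_x (f x ^+ 2)%:E)%E.
Definition sqdist f g := sqnorm (fun x => f x - g x).
Definition L2 f := measurable_fun [set: T] f /\ (sqnorm f < +oo)%E.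
Definition ip f g : R := \int[nu]_x (f x * g x).

Lemma sqnorm_ge0 f : (0 <= sqnorm f)%E.
Proof. by apply: integral_ge0 => x _; rewrite lee_fin sqr_ge0. Qed.

Lemma measurable_EFin_sqr f : measurable_fun [set: T] f ->
  measurable_fun [set: T] (fun x => (f x ^+ 2 : R)%:E).
Proof. by move=> mf; apply/measurable_EFinP; exact: measurable_funX. Qed.

Lemma sqnorm_le f g (c : R) : measurable_fun setT f -> measurable_fun setT g ->
  0 <= c -> (forall x, f x ^+ 2 <= c * g x ^+ 2) -> (sqnorm f <= c%:E * sqnorm g)%E.
Proof.
move=> mf mg c0 fg; rewrite -ge0_integralZl_EFin//; last 2 first.
- by move=> x _; rewrite lee_fin sqr_ge0.
- exact: measurable_EFin_sqr.
apply: ge0_le_integral => //.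
- by move=> x _; rewrite lee_fin sqr_ge0.
- exact: measurable_EFin_sqr.
- by apply: measurable_funeM; exact: measurable_EFin_sqr.
- by move=> x _; rewrite -EFinM lee_fin.
Qed.

Lemma sqnorm_le_add f g h (c : R) :
  measurable_fun setT f -> measurable_fun setT g -> measurable_fun setT h ->
  0 <= c -> (forall x, f x ^+ 2 <= c * (g x ^+ 2 + h x ^+ 2)) ->
  (sqnorm f <= c%:E * (sqnorm g + sqnorm h))%E.
Proof.
move=> mf mg mh c0 fgh; rewrite -ge0_integralD//; last 4 first.
- by move=> x _; rewrite lee_fin sqr_ge0.
- exact: measurable_EFin_sqr.
- by move=> x _; rewrite lee_fin sqr_ge0.
- exact: measurable_EFin_sqr.
rewrite -ge0_integralZl_EFin//; last 2 first.
- by move=> x _; rewrite -EFinD lee_fin addr_ge0 ?sqr_ge0.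
- by apply: emeasurable_funD; exact: measurable_EFin_sqr.
apply: ge0_le_integral => //.
- by move=> x _; rewrite lee_fin sqr_ge0.
- exact: measurable_EFin_sqr.
- by apply/measurable_funeM/emeasurable_funD; exact: measurable_EFin_sqr.
- by move=> x _; rewrite -EFinD -EFinM lee_fin.
Qed.

Lemma L2D f g : L2 f -> L2 g -> L2 (fun x => f x + g x).
Proof.
move=> [mf f2] [mg g2]; have mfg := measurable_funD mf mg; split => //.
apply: le_lt_trans (sqnorm_le_add (c := 2) mfg mf mg _ _) _ => //.
- by move=> x /=; have := sqr_ge0 (f x - g x); nra.
- by apply: lte_mul_pinfty => //; rewrite lte_add_pinfty.
Qed.

Lemma L2Z (c : R) f : L2 f -> L2 (fun x => c * f x).
Proof.
move=> [mf f2]; have mcf : measurable_fun setT (fun x => c * f x).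
  exact: measurable_funM.
split => //; apply: le_lt_trans (sqnorm_le (c := c ^+ 2) mcf mf _ _) _.
- exact: sqr_ge0.
- by move=> x; rewrite exprMn.
- by apply: lte_mul_pinfty => //; rewrite lee_fin sqr_ge0.
Qed.

Lemma L2B f g : L2 f -> L2 g -> L2 (fun x => f x - g x).
Proof.
move=> L2f /(L2Z (-1)) /(L2D L2f).
by under [X in L2 X]eq_fun do rewrite mulN1r.
Qed.

Lemma L2_sum (I : Type) (s : seq I) (F : I -> T -> R) :
  (forall i, L2 (F i)) -> L2 (fun x => \sum_(i <- s) F i x).
Proof.
move=> L2F; elim: s => [|i s ih].
  under [X in L2 X]eq_fun do rewrite big_nil.
  split; first exact: measurable_cst.
  by rewrite /sqnorm integral0_eq// => x _; rewrite expr0n.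
by under [X in L2 X]eq_fun do rewrite big_cons; exact: L2D.
Qed.

Lemma bounded_integrable f : measurable_fun setT f -> (forall x, `|f x| <= 1) ->
  nu.-integrable setT (EFin \o f).
Proof.
move=> mf f1; have i1 : nu.-integrable setT (EFin \o (fun=> 1 : R)).
  exact: finite_measure_integrable_cst.
apply: (le_integrable measurableT _ _ i1); first exact/measurable_EFinP.
by move=> x _ /=; rewrite lee_fin normr1.
Qed.

Lemma L2_bounded f (c : R) : measurable_fun setT f ->
  (forall x, `|f x| <= c) -> L2 f.
Proof.
move=> mf fc; split => //.
have c2 x : f x ^+ 2 <= c ^+ 2.
  by rewrite -(ger0_norm (sqr_ge0 (f x))) normrX ler_pXn2r// nnegrE (le_trans _ (fc x)).
apply: (@le_lt_trans _ _ (\int[nu]_x (cst (c ^+ 2)%:E x))%E).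
  apply: ge0_le_integral => //.
  - by move=> x _; rewrite lee_fin sqr_ge0.
  - exact: measurable_EFin_sqr.
  - by move=> x _; rewrite lee_fin.
rewrite integral_cst//; apply: lte_mul_pinfty => //; first by rewrite lee_fin sqr_ge0.
by rewrite -ge0_fin_numE// fin_num_measure.
Qed.

(** Pointwise $|fg|\le f^2+g^2$. As [ip] is a real-valued integral, this is what makes it additive
    in its arguments. *)
Lemma integrable_mul f g : L2 f -> L2 g ->
  nu.-integrable setT (EFin \o (fun x => f x * g x)).
Proof.
move=> [mf f2] [mg g2]; apply/integrableP; split.
  by apply/measurable_EFinP; exact: measurable_funM.
apply: (@le_lt_trans _ _ (sqnorm f + sqnorm g)%E); last by rewrite lte_add_pinfty.
rewrite -ge0_integralD//; last 4 first.
- by move=> x _; rewrite lee_fin sqr_ge0.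
- exact: measurable_EFin_sqr.
- by move=> x _; rewrite lee_fin sqr_ge0.
- exact: measurable_EFin_sqr.
apply: ge0_le_integral => //.
- by apply: measurableT_comp => //; apply/measurable_EFinP; exact: measurable_funM.
- by apply: emeasurable_funD; exact: measurable_EFin_sqr.
- move=> x _ /=; rewrite lee_fin normrM.
  rewrite -[f x ^+ 2]ger0_norm ?sqr_ge0// -[g x ^+ 2]ger0_norm ?sqr_ge0// !normrX.
  have := sqr_ge0 (`|f x| - `|g x|).
  have := normr_ge0 (f x); have := normr_ge0 (g x); nra.
Qed.

Lemma ipC f g : ip f g = ip g f.
Proof. by apply: eq_Rintegral => x _; rewrite mulrC. Qed.

Lemma ipDl f g h : L2 f -> L2 g -> L2 h ->
  ip (fun x => f x + g x) h = ip f h + ip g h.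
Proof.
move=> f2 g2 h2; rewrite -RintegralD//; [|exact: integrable_mul..].
by apply: eq_Rintegral => x _; rewrite mulrDl.
Qed.

Lemma ipZl (c : R) f h : L2 f -> L2 h -> ip (fun x => c * f x) h = c * ip f h.
Proof.
move=> f2 h2; rewrite -RintegralZl//; last exact: integrable_mul.
by apply: eq_Rintegral => x _; rewrite mulrA.
Qed.

Lemma ipBl f g h : L2 f -> L2 g -> L2 h ->
  ip (fun x => f x - g x) h = ip f h - ip g h.
Proof.
move=> f2 g2 h2; rewrite -RintegralB//; [|exact: integrable_mul..].
by apply: eq_Rintegral => x _; rewrite mulrBl.
Qed.

Lemma ip_suml (I : Type) (s : seq I) (F : I -> T -> R) h :
  (forall i, L2 (F i)) -> L2 h ->
  ip (fun x => \sum_(i <- s) F i x) h = \sum_(i <- s) ip (F i) h.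
Proof.
move=> L2F h2; elim: s => [|i s ih].
  rewrite big_nil /ip; under eq_Rintegral do rewrite big_nil mul0r.
  by rewrite Rintegral_cst// mul0r.
rewrite big_cons -ih -ipDl//; last exact: L2_sum.
by apply: eq_Rintegral => x _; rewrite big_cons.
Qed.

Lemma sqnormE f : L2 f -> sqnorm f = (ip f f)%:E.
Proof.
move=> L2f; have /= ff := integrable_mul L2f L2f.
rewrite /ip /Rintegral fineK; last exact: integrable_fin_num.
by apply: eq_integral => x _; rewrite expr2.
Qed.

End L2.

(** * Polynomials converging to a step at 1/2 *)

Section threshold_sequence.
Variable R : realType.
Implicit Types y z : R.

(** With $w=\sqrt z$ one has $n z^n=(n w^n)\,w^n$. Bernoulli's inequality for $1/w>1$ bounds $n w^n$
    by $w/(1-w)$, and the remaining factor $w^n$ tends to 0. *)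
Lemma cvg_mulrn_expr z : 0 <= z < 1 -> (fun n => n%:R * z ^+ n) @ \oo --> (0 : R).
Proof.
move=> /andP[z0 z1].
have [->|zn0] := eqVneq z 0.
  apply: cvg_near_cst; near=> n; rewrite expr0n gtn_eqF ?mulr0//.
  by near: n; exact: nbhs_infty_gt.
have zp : 0 < z by rewrite lt0r zn0.
pose w := Num.sqrt z.
have w0 : 0 < w by rewrite sqrtr_gt0.
have w2 : w ^+ 2 = z by rewrite sqr_sqrtr.
have w1 : w < 1 by rewrite -(@ltr_pXn2r _ 2)// ?nnegrE ?(ltW w0)// w2 expr1n.
have nw n : n%:R * w ^+ n <= w / (1 - w).
  have e0 : 0 < 1 - w by lra.
  have bern : 1 + n%:R * (w^-1 - 1) <= (w^-1) ^+ n.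
    elim: n => [|n ih]; first by rewrite mul0r addr0 expr0.
    have wv1 : 1 < w^-1 by rewrite invf_gt1.
    have n0 : 0 <= n%:R :> R by [].
    rewrite exprS -natr1.
    apply: (@le_trans _ _ (w^-1 * (1 + n%:R * (w^-1 - 1)))); last first.
      by rewrite ler_wpM2l// invr_ge0 ltW.
    have : 0 <= n%:R * (w^-1 - 1) ^+ 2 by rewrite mulr_ge0// sqr_ge0.
    by nra.
  have wn0 : 0 < w ^+ n by rewrite exprn_gt0.
  have : n%:R * (w^-1 - 1) * w ^+ n <= 1.
    rewrite -[leRHS](@mulVf _ (w ^+ n)) ?gt_eqF// ler_pM2r// -exprVn.
    by apply: le_trans bern; rewrite lerDr.
  rewrite ler_pdivlMr// => H.
  have -> : n%:R * w ^+ n * (1 - w) = w * (n%:R * (w^-1 - 1) * w ^+ n).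
    by field; rewrite gt_eqF.
  by rewrite -[leRHS]mulr1 ler_wpM2l// ltW.
apply: (@squeeze_cvgr _ _ _ _ (fun=> 0) (fun n => w / (1 - w) * w ^+ n)).
- near=> n; rewrite mulr_ge0 ?exprn_ge0//= -w2 -exprM mul2n -addnn exprD mulrA.
  by rewrite ler_wpM2r// exprn_ge0// ltW.
- exact: cvg_cst.
- rewrite -(mulr0 (w / (1 - w))); apply: cvgM; first exact: cvg_cst.
  by apply: cvg_expr; rewrite ger0_norm ?(ltW w0).
Unshelve. all: by end_near. Qed.

Lemma bernoulli_le (n : nat) y : 0 <= y <= 1 -> 1 - n%:R * y <= (1 - y) ^+ n.
Proof.
move=> /andP[y0 y1]; elim: n => [|n ih]; first by rewrite mul0r subr0 expr0.
rewrite exprS -natr1.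
apply: (@le_trans _ _ ((1 - y) * (1 - n%:R * y))).
  have : 0 <= n%:R * y ^+ 2 by rewrite mulr_ge0// sqr_ge0.
  by nra.
by rewrite ler_wpM2l// subr_ge0.
Qed.

(** Induction works because $(1-y)(1+(n+1)y)=1+ny-(n+1)y^2\le 1+ny$. *)
Lemma bernoulli_ge (n : nat) y : 0 <= y <= 1 -> (1 - y) ^+ n * (1 + n%:R * y) <= 1.
Proof.
move=> /andP[y0 y1]; elim: n => [|n ih]; first by rewrite mul0r addr0 expr0 mulr1.
apply: le_trans ih; rewrite exprS -natr1 [_ * (1 - y) ^+ n]mulrC -mulrA.
rewrite ler_wpM2l//; first by rewrite exprn_ge0// subr_ge0.
have : 0 <= n%:R * y ^+ 2 by rewrite mulr_ge0// sqr_ge0.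
by have : 0 <= y ^+ 2; [rewrite sqr_ge0|nra].
Qed.

(* The extra factor [n] in the exponent sends the boundary value [y = 1/2] to 0. *)
Definition thr (n : nat) y : R := (1 - y ^+ n) ^+ (n * 2 ^ n).

Lemma thr01 n y : 0 <= y <= 1 -> 0 <= thr n y <= 1.
Proof.
move=> /andP[y0 y1]; have yn : 0 <= y ^+ n <= 1 by rewrite exprn_ge0// exprn_ile1.
have /andP[yn0 yn1] := yn.
by rewrite exprn_ge0 ?subr_ge0//= exprn_ile1 ?subr_ge0// lerBlDr lerDl.
Qed.

(** Base and exponent of [thr] combine to $n(2y)^n$. Below 1/2 this tends to 0, and [bernoulli_le]
    gives [thr n y] $\ge 1-n(2y)^n$. From 1/2 on it is at least $n$, and [bernoulli_ge] gives
    [thr n y] $\le 1/(n+1)$. *)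
Lemma cvg_thr y : 0 <= y <= 1 -> (fun n => thr n y) @ \oo --> ((y < 2^-1)%R%:R : R).
Proof.
move=> y01; have /andP[y0 y1] := y01.
have yn n : 0 <= y ^+ n <= 1 by rewrite exprn_ge0// exprn_ile1.
have E n : (n * 2 ^ n)%:R * y ^+ n = n%:R * (2 * y) ^+ n.
  by rewrite natrM natrX exprMn mulrA.
have [yh|yh] := ltP y 2^-1.
  apply: (@squeeze_cvgr _ _ _ _ (fun n => 1 - n%:R * (2 * y) ^+ n) (fun=> 1)).
  - near=> n; rewrite -E bernoulli_le//=.
    by have /andP[] := thr01 n y01.
  - rewrite -[X in _ --> X]subr0; apply: cvgB; first exact: cvg_cst.
    by apply: cvg_mulrn_expr; apply/andP; split; lra.
  - exact: cvg_cst.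
apply: (@squeeze_cvgr _ _ _ _ (fun=> 0) (fun n => n.+1%:R^-1)).
- near=> n; have /andP[-> _] /= := thr01 n y01.
  rewrite -[leRHS]mul1r ler_pdivlMr//.
  apply: le_trans (bernoulli_ge (n * 2 ^ n) (yn n)).
  rewrite ler_wpM2l//; first by have /andP[] := thr01 n y01.
  rewrite E -natr1 addrC lerD2l -[leLHS]mulr1 ler_wpM2l//.
  by rewrite exprn_ege1//; lra.
- exact: cvg_cst.
- exact: (@cvg_harmonic R).
Unshelve. all: by end_near. Qed.

End threshold_sequence.

(** * Closure of the trigonometric polynomials *)

Section trigonometric_bounds.
Variable R : realType.

Lemma norm_cos_le1 (x : R) : `|cos x| <= 1.
Proof. by rewrite ler_norml cos_geN1 cos_le1. Qed.

Lemma norm_sin_le1 (x : R) : `|sin x| <= 1.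
Proof. by rewrite ler_norml sin_geN1 sin_le1. Qed.

End trigonometric_bounds.

Section density.
Context d (T : measurableType d) (R : realType).
Variable nu : {finite_measure set T -> \bar R}.
Variables (I : zmodType) (th : I -> T -> R).
Hypothesis measurable_th : forall i, measurable_fun setT (th i).
Hypothesis thD : forall i j x, th (i + j) x = th i x + th j x.
Implicit Types (f g h : T -> R) (i j : I).

(* Hartley's kernel: a single real family, orthonormal when indexed by all
   frequencies, in place of the pairs (cos, sin). *)
Definition cas i x : R := cos (th i x) + sin (th i x).

Definition trig (s : seq (R * I)) x : R := \sum_(p <- s) p.1 * cas p.2 x.

(** The number [e] bounds a squared distance. *)
Definition span_closure f := measurable_fun setT f /\
  forall e : R, 0 < e -> exists s, (sqdist nu f (trig s) <= e%:E)%E.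

Local Notation M := span_closure.

Lemma th0 x : th 0 x = 0.
Proof. by have := thD 0 0 x; rewrite addr0 => /eqP; rewrite -subr_eq0 opprD addNKr oppr_eq0 => /eqP. Qed.

Lemma thN i x : th (- i) x = - th i x.
Proof. by apply/eqP; rewrite -subr_eq0 opprK -thD addNr th0. Qed.

Lemma casN i x : cas (- i) x = cos (th i x) - sin (th i x).
Proof. by rewrite /cas thN cosN sinN. Qed.

Lemma measurable_cos_th i : measurable_fun setT (fun x => cos (th i x)).
Proof.
apply: measurableT_comp => //; apply: continuous_measurable_fun.
exact: continuous_cos.
Qed.

Lemma measurable_sin_th i : measurable_fun setT (fun x => sin (th i x)).
Proof.
apply: measurableT_comp => //; apply: continuous_measurable_fun.
exact: continuous_sin.
Qed.

Lemma measurable_cas i : measurable_fun setT (cas i).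
Proof.
by apply: measurable_funD; [exact: measurable_cos_th|exact: measurable_sin_th].
Qed.

Lemma measurable_trig s : measurable_fun setT (trig s).
Proof. by apply: measurable_sum => p; apply: measurable_funM => //; exact: measurable_cas. Qed.

Lemma cas_norm i x : `|cas i x| <= 2.
Proof.
rewrite (le_trans (ler_normD _ _))// (_ : 2 = 1 + 1)// lerD// ler_norml.
  by rewrite cos_geN1 cos_le1.
by rewrite sin_geN1 sin_le1.
Qed.

(** The product is $\cos(\theta_i-\theta_j)+\sin(\theta_i+\theta_j)$, and cosine and sine are half
    the sum and half the difference of [cas] at opposite frequencies. Hence trigonometric
    polynomials are closed under products. *)
Lemma cas_mul i j x : cas i x * cas j x =
  2^-1 * cas (i - j) x + 2^-1 * cas (j - i) x
  + (2^-1 * cas (i + j) x - 2^-1 * cas (- (i + j)) x).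
Proof.
rewrite casN /cas !thD !thN !(cosD, sinD, cosN, sinN).
by field.
Qed.

Lemma closureP f : measurable_fun setT f ->
  (forall e : R, 0 < e -> exists2 g, M g & (sqdist nu f g <= e%:E)%E) ->
  M f.
Proof.
move=> mf fM; split => // e e0.
(* Two errors of size $e/4$ combine to $2(e/4+e/4)=e$. *)
have e4 : 0 < e / 4 by rewrite divr_gt0.
have [g [mg Mg] fg] := fM _ e4; have [s gs] := Mg _ e4; exists s.
have mt := measurable_trig s.
apply: (le_trans (sqnorm_le_add nu (c := 2) (measurable_funB mf mt)
  (measurable_funB mf mg) (measurable_funB mg mt) _ _)) => //.
  by move=> x /=; have := sqr_ge0 (f x - g x - (g x - trig s x)); nra.
apply: (le_trans (lee_wpmul2l _ (leeD fg gs))) => //.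
by rewrite -EFinD -EFinM lee_fin; lra.
Qed.

Lemma closure_trig s : M (trig s).
Proof.
split; first exact: measurable_trig.
move=> e e0; exists s; rewrite /sqdist /sqnorm integral0_eq ?lee_fin ?ltW// => x _.
by rewrite subrr expr0n.
Qed.

Lemma closure_cas i : M (cas i).
Proof.
have := closure_trig [:: (1, i)].
by congr (M _); apply/funext => x; rewrite /trig big_seq1 mul1r.
Qed.

Lemma closureD f g : M f -> M g -> M (fun x => f x + g x).
Proof.
move=> [mf Mf] [mg Mg]; split; first exact: measurable_funD.
move=> e e0; have e4 : 0 < e / 4 by rewrite divr_gt0.
have [s fs] := Mf _ e4; have [t gt] := Mg _ e4; exists (s ++ t).
have [ms mt] := (measurable_trig s, measurable_trig t).
have E x : trig (s ++ t) x = trig s x + trig t x by rewrite /trig big_cat.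
apply: (le_trans (sqnorm_le_add nu (c := 2) _
  (measurable_funB mf ms) (measurable_funB mg mt) _ _)) => //.
- by apply: measurable_funB; [exact: measurable_funD|exact: measurable_trig].
- move=> x /=; rewrite E.
  by have := sqr_ge0 (f x - trig s x - (g x - trig t x)); nra.
apply: (le_trans (lee_wpmul2l _ (leeD fs gt))) => //.
by rewrite -EFinD -EFinM lee_fin; lra.
Qed.

(** Multiplication by [g] multiplies squared distances by at most $c^2$, so it is enough to know the
    products of [g] with trigonometric polynomials. *)
Lemma closureM_bounded f g (c : R) : (forall x, `|g x| <= c) -> measurable_fun setT g ->
  (forall s, M (fun x => trig s x * g x)) -> M f -> M (fun x => f x * g x).
Proof.
move=> gc mg Mtg [mf Mf].
(* The sign of [c] is read off at a point, since [T] may be empty. *)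
have c0 (x : T) : 0 <= c by rewrite (le_trans _ (gc x)).
apply: closureP; first exact: measurable_funM.
(* Adding 1 avoids a division by zero when [c] is 0. *)
move=> e e0; have c2 : 0 < c ^+ 2 + 1 by rewrite ltr_wpDl// sqr_ge0.
have [s fs] := Mf (e / (c ^+ 2 + 1)) (divr_gt0 e0 c2).
exists (fun x => trig s x * g x) => //.
have ms := measurable_trig s.
apply: (le_trans (sqnorm_le nu (c := c ^+ 2) _ (measurable_funB mf ms) _ _)).
- by apply: measurable_funB; exact: measurable_funM.
- exact: sqr_ge0.
- move=> x /=; rewrite -mulrBl exprMn mulrC ler_wpM2r ?sqr_ge0//.
  by rewrite -real_normK ?num_real// ler_pXn2r ?nnegrE// (c0 x).
apply: (le_trans (lee_wpmul2l _ fs)); first by rewrite lee_fin sqr_ge0.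
rewrite -EFinM lee_fin mulrCA ger_pMr// ler_pdivrMr// mul1r lerDl//.
Qed.

Lemma closureZ (c : R) f : M f -> M (fun x => c * f x).
Proof.
move=> Mf; have -> : (fun x => c * f x) = (fun x => f x * c).
  by apply/funext => x; rewrite mulrC.
apply: (@closureM_bounded _ _ `|c|) => // s.
have := closure_trig [seq (c * p.1, p.2) | p <- s]; congr (M _).
apply/funext => x; rewrite /trig big_map mulr_suml.
by apply: eq_bigr => p _ /=; ring.
Qed.

Lemma closureB f g : M f -> M g -> M (fun x => f x - g x).
Proof.
move=> Mf /(closureZ (-1)) /(closureD Mf).
by congr (M _); apply/funext => x; rewrite mulN1r.
Qed.

Lemma closure_sum (J : Type) (s : seq J) (F : J -> T -> R) :
  (forall k, M (F k)) -> M (fun x => \sum_(i <- s) F i x).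
Proof.
move=> MF; elim: s => [|k s ih].
  have := closure_trig [::]; congr (M _); apply/funext => x.
  by rewrite /trig !big_nil.
by have := closureD (MF k) ih; congr (M _); apply/funext => x; rewrite big_cons.
Qed.

(** Two reductions: the bound on [g] replaces [f] by a trigonometric polynomial, then the bound on
    [cas] replaces [g] by one. What is left is a product of two kernels, handled by [cas_mul]. *)
Lemma closureM f g (c : R) : (forall x, `|g x| <= c) -> M f -> M g ->
  M (fun x => f x * g x).
Proof.
move=> gc Mf Mg; apply: (closureM_bounded gc) => //; first by case: Mg.
move=> s; have -> : (fun x => trig s x * g x) =
    (fun x => \sum_(p <- s) p.1 * (g x * cas p.2 x)).
  apply/funext => x; rewrite /trig mulr_suml.
  by apply: eq_bigr => p _; rewrite -mulrA [_ * g x]mulrC.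
apply: closure_sum => p; apply: closureZ.
apply: (closureM_bounded (cas_norm p.2)) => //; first exact: measurable_cas.
move=> t; have -> : (fun x => trig t x * cas p.2 x) =
    (fun x => \sum_(q <- t) q.1 * (cas q.2 x * cas p.2 x)).
  apply/funext => x; rewrite /trig mulr_suml.
  by apply: eq_bigr => q _; rewrite -mulrA.
apply: closure_sum => q; apply: closureZ.
have -> := funext (cas_mul q.2 p.2).
apply: closureD; first by apply: closureD; exact/closureZ/closure_cas.
by apply: closureB; exact/closureZ/closure_cas.
Qed.

Lemma closure_cst (c : R) : M (fun=> c).
Proof.
have := closureZ c (closure_cas 0); congr (M _); apply/funext => x.
by rewrite /cas th0 cos0 sin0 addr0 mulr1.
Qed.

Lemma closureX f n : (forall x, `|f x| <= 1) -> M f -> M (fun x => f x ^+ n).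
Proof.
move=> f1 Mf; elim: n => [|n ih]; first exact: closure_cst.
have -> : (fun x => f x ^+ n.+1) = (fun x => f x ^+ n * f x).
  by apply/funext => x; rewrite exprSr.
exact: (closureM f1).
Qed.

Lemma closure_cos i : M (fun x => cos (th i x)).
Proof.
have := closureZ 2^-1 (closureD (closure_cas i) (closure_cas (- i))).
by congr (M _); apply/funext => x; rewrite casN /cas; field.
Qed.

Lemma closure_sin i : M (fun x => sin (th i x)).
Proof.
have := closureZ 2^-1 (closureB (closure_cas i) (closure_cas (- i))).
by congr (M _); apply/funext => x; rewrite casN /cas; field.
Qed.

(** Dominated convergence applied to the squared errors; accordingly [G] dominates these errors and
    not the functions [F n]. *)
Lemma closure_cvg (F : nat -> T -> R) f (G : T -> R) :
  (forall n, M (F n)) -> measurable_fun setT f ->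
  (forall x, F n x @[n --> \oo] --> f x) ->
  (forall n x, (f x - F n x) ^+ 2 <= G x) ->
  nu.-integrable setT (EFin \o G) -> M f.
Proof.
move=> MF mf Ff FG iG; apply: closureP => // e e0.
have mD n : measurable_fun setT (fun x => f x - F n x).
  by apply: measurable_funB => //; case: (MF n).
have [||||| _ _] := @dominated_convergence _ _ _ nu setT measurableT
  (fun n x => ((f x - F n x) ^+ 2 : R)%:E) (fun=> 0%E) (EFin \o G).
- by move=> n; exact: measurable_EFin_sqr.
- exact: measurable_cst.
- apply: aeW => x _; apply: cvg_EFin; first exact: nearW.
  rewrite (_ : fine \o _ = (fun n => (f x - F n x) ^+ 2)); last by apply/funext.
  have fFx : f x - F n x @[n --> \oo] --> 0.
    by rewrite -(subrr (f x)); apply: cvgB => //; exact: cvg_cst.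
  by rewrite -[X in _ --> X](mulr0 0); apply: cvgM.
- exact: iG.
- by apply: aeW => x n _ /=; rewrite ger0_norm ?sqr_ge0// lee_fin.
rewrite integral0 => H.
have e0' : (0 < e%:E)%E by rewrite lte_fin.
have [n _ /(_ n (leqnn n)) fn] := H _ (open_ereal_lt' e0').
by exists (F n) => //; exact: ltW.
Qed.

Definition in_algebra (A : set T) := measurable A /\ M \1_A.

(** Each [thr n] is a polynomial, so [thr n (h x)] stays in the closure; it converges pointwise to
    the indicator of the set and keeps its values in $[0,1]$. *)
Lemma closure_threshold h : M h -> (forall x, 0 <= h x <= 1) ->
  in_algebra [set x | h x < 2^-1].
Proof.
move=> Mh h01; have [mh _] := Mh.
have mA : measurable [set x | h x < 2^-1].
  rewrite (_ : [set x | _] = setT `&` h @^-1` `]-oo, 2^-1[%classic); first exact: mh.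
  by rewrite setTI; apply/seteqP; split => x /=; rewrite in_itv.
split => //; have h1 x : `|h x| <= 1 by rewrite ger0_norm; case/andP: (h01 x).
have indE x : \1_[set x | h x < 2^-1] x = (h x < 2^-1)%R%:R :> R.
  by rewrite indicE; congr (nat_of_bool _)%:R; apply/idP/idP; rewrite inE.
apply: (@closure_cvg (fun n x => thr n (h x)) _ (cst 1)).
- move=> n; apply: closureX.
    move=> x; have /andP[h0 h1'] := h01 x.
    by rewrite ger0_norm ?subr_ge0 ?exprn_ile1// lerBlDr lerDl exprn_ge0.
  by apply: closureB; [exact: closure_cst|exact: closureX].
- exact: measurable_indic.
- by move=> x; rewrite indE; exact: cvg_thr.
- move=> n x /=; rewrite indE.
  have /andP[t0 t1] := thr01 n (h01 x).
  by case: (h x < 2^-1) => /=; nra.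
- exact: finite_measure_integrable_cst.
Qed.

Lemma in_algebraC A : in_algebra A -> in_algebra (~` A).
Proof.
move=> [mA MA]; split; first exact: measurableC.
have := closureB (closure_cst 1) MA; congr (M _); apply/funext => x.
by rewrite !indicE in_setC; case: (x \in A); rewrite /= ?subrr ?subr0.
Qed.

Lemma in_algebra_bigcup (A : (set T)^nat) : (forall n, in_algebra (A n)) ->
  in_algebra (\bigcup_n A n).
Proof.
move=> mMA; have mA : measurable (\bigcup_n A n).
  by apply: bigcupT_measurable => n; case: (mMA n).
split => //.
(* $1-F_n$ is the indicator of the union of the first [n] sets; at each point the sequence is
   eventually constant. *)
pose F n x : R := \prod_(k < n) (1 - \1_(A k) x).
have F01 n x : 0 <= F n x <= 1.
  rewrite /F; elim/big_rec: _ => [|k y _ /andP[y0 y1]]; first by rewrite ler01 lexx.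
  by rewrite indicE; case: (x \in A k); rewrite /= ?subrr ?subr0 ?mul0r ?mul1r ?lexx ?ler01// y0.
have MF n : M (F n).
  elim: n => [|n ih].
    by have := closure_cst 1; congr (M _); apply/funext => x; rewrite /F big_ord0.
  have F1 x : `|F n x| <= 1 by rewrite ger0_norm; case/andP: (F01 n x).
  have := closureM F1 (closureB (closure_cst 1) (mMA n).2) ih; congr (M _).
  by apply/funext => x; rewrite /F big_ord_recr mulrC.
apply: (@closure_cvg (fun n x => 1 - F n x) _ (cst 1)).
- by move=> n; apply: closureB => //; exact: closure_cst.
- exact: measurable_indic.
- move=> x; rewrite indicE; have [|xA] := boolP (x \in _).
    rewrite inE => -[k _ Ak]; apply: cvg_near_cst; near=> n.
    have kn : (k < n)%N by near: n; exact: nbhs_infty_gt.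
    by rewrite /F (bigD1 (Ordinal kn))//= indicE mem_set// subrr mul0r subr0.
  apply: cvg_near_cst; near=> n.
  rewrite /F big1 ?subrr// => k _; rewrite indicE memNset ?subr0//.
  by apply: contraNnot xA => Ak; rewrite inE; exists k.
- move=> n x /=; have /andP[F0 F1] := F01 n x; rewrite indicE.
  by case: (x \in _) => /=; nra.
- exact: finite_measure_integrable_cst.
Unshelve. all: by end_near. Qed.

Lemma sigma_algebra_in_algebra : sigma_algebra setT in_algebra.
Proof.
split.
- split; first exact: measurable0.
  by have := closure_cst 0; congr (M _); apply/funext => x; rewrite indic0.
- by move=> A; rewrite setTD; exact: in_algebraC.
- exact: in_algebra_bigcup.
Qed.

Lemma closure_ae f g : M f -> measurable_fun setT g -> sqdist nu g f = 0%E -> M g.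
Proof.
move=> Mf mg gf; apply: closureP => // e e0.
by exists f => //; rewrite gf lee_fin ltW.
Qed.

(** The density assumption, established for the cube in [in_algebra_cube]. *)
Hypothesis algebraT : forall A, measurable A -> in_algebra A.

Import HBNNSimple HBSimple.

(** Simple functions $F_n$ increase to $f$; from $0\le F_n\le f$ the squared error is at most $f^2$,
    which is integrable. *)
Lemma closure_ge0 f : (forall x, 0 <= f x) -> L2 nu f -> M f.
Proof.
move=> f0 [mf f2]; have mEf : measurable_fun setT (EFin \o f) by exact/measurable_EFinP.
pose F n : T -> R := nnsfun_approx measurableT mEf n.
have Ff x : F n x @[n --> \oo] --> f x.
  have f0' y : setT y -> (0 <= (EFin \o f) y)%E by move=> _; rewrite lee_fin.
  have := @cvg_nnsfun_approx _ _ _ _ measurableT _ mEf f0' x Logic.I.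
  by move=> /fine_cvgP[].
have Fle n x : F n x <= f x.
  have /cvgP cF := Ff x.
  rewrite -(cvg_lim _ (Ff x))//; apply: nondecreasing_cvgn_le => //.
  by move=> a b ab; have /lefP := @nd_nnsfun_approx _ _ _ _ measurableT _ mEf a b ab; exact.
have F0 n x : 0 <= F n x by [].
apply: (@closure_cvg F _ (fun x => f x ^+ 2)) => //.
(* A simple function is the finite sum of its values times the indicators of its level sets. *)
- move=> n; rewrite /F; move: (nnsfun_approx _ _ n) => h.
  have -> : (h : T -> R) = (fun x => \sum_(y <- finmap.enum_fset (fset_set (range h))) (y * \1_(h @^-1` [set y]) x)).
    by apply/funext => x; rewrite {1}fimfunE fsbig_finite.
  by apply: closure_sum => y; apply: closureZ; apply: (algebraT _).2.
- by move=> n x; have := Fle n x; have := F0 n x; have := f0 x; nra.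
- have := integrable_mul (conj mf f2) (conj mf f2).
  by congr (_.-integrable _ _); apply/funext => x /=; rewrite expr2.
Qed.

Lemma closure_L2 f : L2 nu f -> M f.
Proof.
move=> [mf f2].
have L2p g : measurable_fun setT g -> (forall x, g x ^+ 2 <= f x ^+ 2) -> L2 nu g.
  move=> mg gf; split => //; apply: le_lt_trans f2.
  rewrite -[leRHS]mul1e; apply: sqnorm_le => // x; by rewrite mul1r.
have -> : f = (fun x => Num.max (f x) 0 - Num.max (- f x) 0).
  by apply/funext => x; rewrite !maxElt; case: ltP => ?; case: ltP => ?; lra.
apply: closureB; apply: closure_ge0.
- by move=> x; rewrite le_max lexx orbT.
- apply: L2p; first exact: measurable_maxr.
  by move=> x; rewrite maxElt; case: ltP => // _; rewrite expr0n/= sqr_ge0.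
- by move=> x; rewrite le_max lexx orbT.
- apply: L2p; first by apply: measurable_maxr => //; exact: measurable_funN.
  by move=> x; rewrite maxElt; case: ltP => // _; rewrite ?expr0n/= ?sqrrN ?sqr_ge0.
Qed.

End density.

(** * Parseval's identity for a dense orthonormal trigonometric family *)

Section parseval.
Context d (T : measurableType d) (R : realType).
Variable nu : {finite_measure set T -> \bar R}.
Variables (I : zmodType) (th : I -> T -> R).
Hypothesis measurable_th : forall i, measurable_fun setT (th i).
Hypothesis thD : forall i j x, th (i + j) x = th i x + th j x.
Hypothesis int_cos : forall i, \int[nu]_x cos (th i x) = (i == 0)%:R.
Hypothesis int_sin : forall i, \int[nu]_x sin (th i x) = 0.
Implicit Types (f g h u v : T -> R) (i j : I).

Local Notation cas := (cas th).
Local Notation ip := (ip nu).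

Lemma L2_cos i : L2 nu (fun x => cos (th i x)).
Proof.
apply: (@L2_bounded _ _ _ _ _ 1); first exact: measurable_cos_th.
by move=> x; exact: norm_cos_le1.
Qed.

Lemma L2_sin i : L2 nu (fun x => sin (th i x)).
Proof.
apply: (@L2_bounded _ _ _ _ _ 1); first exact: measurable_sin_th.
by move=> x; exact: norm_sin_le1.
Qed.

Lemma L2_cas i : L2 nu (cas i).
Proof. by apply: L2D; [exact: L2_cos|exact: L2_sin]. Qed.

(** The product of the kernels is $\cos(\theta_i-\theta_j)+\sin(\theta_i+\theta_j)$, and only the
    cosine at frequency 0 has a nonzero integral. *)
Lemma ip_cas i j : ip (cas i) (cas j) = (i == j)%:R.
Proof.
rewrite -subr_eq0 -int_cos -[RHS]addr0 -(int_sin (i + j)) -RintegralD//; last 2 first.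
- by apply: bounded_integrable => [|x]; [exact: measurable_cos_th|exact: norm_cos_le1].
- by apply: bounded_integrable => [|x]; [exact: measurable_sin_th|exact: norm_sin_le1].
apply: eq_Rintegral => x _.
by rewrite /cas !thD thN// cosB sinD; ring.
Qed.

(** A list may repeat a frequency; adding the coefficients of equal frequencies makes orthonormality
    applicable. *)
Lemma trig_canonical (s : seq (R * I)) : exists F (a : I -> R), uniq F /\
  trig th s = (fun x => \sum_(k <- F) a k * cas k x).
Proof.
exists (undup [seq p.2 | p <- s]), (fun k => \sum_(p <- s | p.2 == k) p.1).
split; first exact: undup_uniq.
apply/funext => x; rewrite /trig.
under [RHS]eq_bigr do rewrite mulr_suml big_mkcond.
rewrite exchange_big/= big_seq [RHS]big_seq; apply: eq_bigr => p ps.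
rewrite (bigD1_seq p.2) ?undup_uniq//=; last by rewrite mem_undup map_f.
by rewrite eqxx big1 ?addr0// => i; rewrite eq_sym => /negPf ->.
Qed.

(** Pythagoras: the squared distance is the defect in Bessel's inequality plus the squared distance
    between the coefficients. The choice of Fourier coefficients for [a] gives Bessel; dropping the
    last sum gives the converse bound in [parseval_cas]. *)
Lemma sqdist_expand f (F : seq I) (a : I -> R) : L2 nu f -> uniq F ->
  let p := fun x => \sum_(k <- F) a k * cas k x in
  sqdist nu f p = (ip f f - \sum_(k <- F) ip f (cas k) ^+ 2
                   + \sum_(k <- F) (a k - ip f (cas k)) ^+ 2)%:E.
Proof.
move=> f2 uF p; have p2 : L2 nu p by apply: L2_sum => k; exact/L2Z/L2_cas.
have pE h : L2 nu h -> ip p h = \sum_(k <- F) a k * ip (cas k) h.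
  move=> h2; rewrite /p ip_suml//; last by move=> k; exact/L2Z/L2_cas.
  by apply: eq_bigr => k _; rewrite ipZl//; exact: L2_cas.
rewrite /sqdist sqnormE; last exact: L2B.
rewrite ipBl//; last exact: L2B.
rewrite (ipC _ f) (ipC _ p) !ipBl// [ip f p]ipC; congr _%:E.
have -> : ip p p = \sum_(k <- F) a k ^+ 2.
  rewrite pE//= big_seq [RHS]big_seq; apply: eq_bigr => k kF; rewrite ipC pE; last exact: L2_cas.
  rewrite (bigD1_seq k)//= ip_cas eqxx mulr1 big1 ?addr0 ?expr2// => j jk.
  by rewrite ip_cas (negPf jk) mulr0.
rewrite pE// -addrA -[RHS]addrA; congr (_ + _).
rewrite opprB -!sumrN -!big_split/=; apply: eq_bigr => k _; rewrite [ip (cas k) f]ipC; ring.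
Qed.

Lemma bessel f (F : seq I) : L2 nu f -> uniq F ->
  \sum_(k <- F) ip f (cas k) ^+ 2 <= ip f f.
Proof.
move=> f2 uF; have := sqnorm_ge0 nu (fun x => f x - \sum_(k <- F) ip f (cas k) * cas k x).
rewrite -/(sqdist nu f (fun x => \sum_(k <- F) ip f (cas k) * cas k x)) sqdist_expand// lee_fin.
by rewrite [X in _ + X]big1 ?addr0 ?subr_ge0// => k _; rewrite subrr expr0n.
Qed.

(** Bessel bounds every finite partial sum. Conversely, the frequencies of a trigonometric
    polynomial within [e] of [f] already carry all of the norm but [e]. *)
Lemma parseval_cas f : L2 nu f -> span_closure nu th f ->
  (\esum_(i in [set: I]) (ip f (cas i) ^+ 2)%:E = sqnorm nu f)%E.
Proof.
move=> f2 [_ Mf]; rewrite sqnormE//; apply/eqP; rewrite eq_le; apply/andP; split.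
  apply: ge_ereal_sup => _ [X [finX _] <-].
  by rewrite fsbig_finite// sumEFin lee_fin bessel// finmap.fset_uniq.
apply/lee_addgt0Pr => e e0; have [s] := Mf _ e0.
have [F [a [uF ->]]] := trig_canonical s.
rewrite sqdist_expand// lee_fin => le_e.
apply: (@le_trans _ _ ((\sum_(k <- F) ip f (cas k) ^+ 2)%:E + e%:E)%E).
  have : 0 <= \sum_(k <- F) (a k - ip f (cas k)) ^+ 2.
    by apply: sumr_ge0 => k _; exact: sqr_ge0.
  by rewrite -EFinD lee_fin; lra.
rewrite leeD2r//; apply: esum_ge; exists [set` F]; last by rewrite -fsbig_seq// sumEFin.
by split => //; exact: finite_seq.
Qed.

(** [coef_re] and [coef_im] are the real and imaginary parts of $\int (u+iv)\,e^{-i\theta}\,d\nu$,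
    where $\theta$ is the phase [th] at the given index. *)
Definition coef_re u v i : R :=
  \int[nu]_x (u x * cos (th i x) + v x * sin (th i x)).

Definition coef_im u v i : R :=
  \int[nu]_x (v x * cos (th i x) - u x * sin (th i x)).

Definition coef2 u v i : R := coef_re u v i ^+ 2 + coef_im u v i ^+ 2.

Lemma parseval u v : L2 nu u -> L2 nu v -> (forall f, L2 nu f -> span_closure nu th f) ->
  (\esum_(i in [set: I]) (coef2 u v i)%:E = sqnorm nu u + sqnorm nu v)%E.
Proof.
move=> u2 v2 dense.
pose C f i := ip f (fun x => cos (th i x)).
pose S f i := ip f (fun x => sin (th i x)).
have coefE i : coef2 u v i = (C u i + S v i) ^+ 2 + (C v i - S u i) ^+ 2.
  rewrite /coef2 /coef_re /coef_im RintegralD ?RintegralB//; apply: integrable_mul => //;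
    by [exact: L2_cos|exact: L2_sin].
have casE f i : L2 nu f -> ip f (cas i) = C f i + S f i.
  by move=> f2; rewrite ipC ipDl// ?[ip _ f]ipC//; [exact: L2_cos|exact: L2_sin].
have CN f i : C f (- i) = C f i.
  by apply: eq_Rintegral => x _; rewrite thN// cosN.
have SN f i : L2 nu f -> S f (- i) = - S f i.
  move=> f2; rewrite /S ipC -[RHS]mulN1r [ip f _]ipC -ipZl//; last exact: L2_sin.
  by apply: eq_Rintegral => x _; rewrite thN// sinN mulN1r.
have bijN : set_bij [set: I] [set: I] (-%R : I -> I).
  by rewrite setTT_bijective; exact: inv_bij opprK.
have dbl (g : I -> R) : (forall i, 0 <= g i) ->
    (\esum_(i in [set: I]) (g i + g (- i))%:E
     = \esum_(i in [set: I]) (g i)%:E + \esum_(i in [set: I]) (g i)%:E)%E.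
  move=> g0; rewrite [X in (_ = _ + X)%E](reindex_esum _ _ _ _ bijN).
  by rewrite -esumD// => i _; rewrite lee_fin.
(* The coefficients at [i] and [- i] are treated together: only their sum is
   the same in the complex and in the Hartley system. *)
have inj2 (x y : \bar R) : (x + x = y + y -> x = y)%E.
  by case: x => [x| |]; case: y => [y| |]//; rewrite -!EFinD => -[?]; congr _%:E; lra.
rewrite -(parseval_cas u2 (dense _ u2)) -(parseval_cas v2 (dense _ v2)) -esumD; last 2 first.
- by move=> i _; rewrite lee_fin sqr_ge0.
- by move=> i _; rewrite lee_fin sqr_ge0.
under [RHS]eq_esum do rewrite -EFinD.
apply: inj2; rewrite -!dbl; last 2 first.
- by move=> i; rewrite addr_ge0 ?sqr_ge0.
- by move=> i; rewrite addr_ge0 ?sqr_ge0.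
(* The cross terms cancel: both sides equal $2(C_u^2+S_u^2+C_v^2+S_v^2)$ at [i]. *)
apply: eq_esum => i _; congr _%:E.
by rewrite !coefE !casE// !CN !SN//; ring.
Qed.

End parseval.

(** * The unit cube *)

Section cube_prob.
Variable R : realType.

(* [uniform_prob] lives on [measurableTypeR R], which has the Borel sets of [R] but
   another display. *)
Definition cons_pair n (p : measurableTypeR R * n.-tuple R) : n.+1.-tuple R :=
  [tuple of (p.1 : R) :: p.2].

Lemma measurable_cons_pair n : measurable_fun setT (@cons_pair n).
Proof. exact: measurable_cons. Qed.

HB.instance Definition _ n := isMeasurableFun.Build _ _ _ _ _ (@measurable_cons_pair n).

(** The uniform measure on the cube, built one coordinate at a time so that it follows the recursion
    of [cube_int]; the product measure is transported from pairs to tuples. *)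
Fixpoint cube_prob n : probability (n.-tuple R) R :=
  match n with
  | 0%N => \d_([tuple] : 0.-tuple R)
  | n'.+1 => distribution (uniform_prob (@ltr01 R) \x cube_prob n')%E (@cons_pair n')
  end.

Lemma cube_intE n (g : n.-tuple R -> \bar R) : measurable_fun setT g ->
  (forall x, 0 <= g x)%E -> cube_int g = (\int[cube_prob n]_x g x)%E.
Proof.
elim: n g => [|n ih] g mg g0.
  by rewrite /= integral_dirac// diracT mul1e.
have mgc : measurable_fun setT (g \o @cons_pair n).
  by apply: measurableT_comp => //; exact: measurable_cons_pair.
have g0c x : (0 <= (g \o @cons_pair n) x)%E by exact: g0.
rewrite [RHS]ge0_integral_distribution// (fubini_tonelli1 _ mgc g0c).
rewrite integral_uniform//; last 2 first.
- exact: measurable_fun_fubini_tonelli_F.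
- by move=> t; apply: integral_ge0 => y _; exact: g0.
rewrite subr0 invr1 mul1e [LHS]/=; apply: eq_integral => t _.
rewrite ih//; apply: (measurableT_comp mg).
exact: measurable_cons.
Qed.

End cube_prob.

Lemma Rintegral_probability_cst (R : realType) d (T : measurableType d) (P : probability T R) (c : R) :
  \int[P]_x c = c.
Proof. by rewrite Rintegral_cst//= (_ : P setT = 1%E) ?mulr1//; exact: probability_setT. Qed.

(** * Trigonometric integrals on the unit interval *)

Section unit_interval.
Variable R : realType.
Local Notation unif := (uniform_prob (@ltr01 R)).

Lemma uniform_itvoo : unif `]0, 1[%classic = 1%E.
Proof.
rewrite -[unif _]mul1e -(setIT `]0, 1[%classic).
have m01 : measurable (`]0, 1[%classic : set (measurableTypeR R)) by exact: measurable_itv.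
rewrite mul1e -(integral_indic unif)// integral_uniform//; last first.
  by apply/measurable_EFinP; exact: measurable_indic.
rewrite subr0 invr1 mul1e integral_indic//=.
rewrite (_ : _ `&` _ = `]0, 1[%classic); last first.
  by apply: setIidl; apply: subset_itv; rewrite bnd_simp.
by rewrite lebesgue_measure_itv/= lte_fin ltr01 -EFinB subr0.
Qed.

Lemma uniform_setC_itvoo : unif (~` `]0, 1[%classic) = 0%E.
Proof.
have m01 : measurable (`]0, 1[%classic : set (measurableTypeR R)) by exact: measurable_itv.
by rewrite (probability_setC unif m01) /= [X in (1 - X)%E]uniform_itvoo subee.
Qed.

Lemma Rintegral_uniform_FTC (f F : R -> R) : (forall x, `|f x| <= 1) ->
  continuous f -> (forall x : R, is_derive x 1 F (f x)) ->
  \int[unif]_x f x = F 1 - F 0.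
Proof.
move=> f1 cf dF.
have mf : measurable_fun setT f by exact: continuous_measurable_fun.
have dF' (x : R) : derivable F x 1 by exact: ex_derive.
(* [integral_uniform] only handles nonnegative integrands, hence the shift by 1. *)
have f1E : (\int[unif]_x (1 + f x)%:E = (1 + (F 1 - F 0))%:E)%E.
  rewrite integral_uniform//; last 2 first.
  - by apply/measurable_EFinP; exact: measurable_funD.
  - by move=> x; rewrite lee_fin; have := f1 x; rewrite ler_norml => /andP[]; lra.
  rewrite subr0 invr1 mul1e (@continuous_FTC2 _ _ (fun x => x + F x))//.
  - by rewrite -EFinB; congr _%:E; ring.
  - apply: continuous_subspaceT => x; apply: cvgD; [exact: cvg_cst|exact: cf].
  - have dG x : derivable (fun x => x + F x) x 1.
      exact: derivableD.
    have cG x : {for x, continuous (fun x => x + F x)}.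
      exact/differentiable_continuous/derivable1_diffP.
    split; first by move=> x _.
      exact/cvg_at_right_filter/cG.
    exact/cvg_at_left_filter/cG.
  - move=> x _; rewrite derive1E deriveD//.
    by rewrite derive_id (@derive_val _ _ _ _ _ _ _ (dF x)).
have if1 : unif.-integrable setT (EFin \o f) by exact: bounded_integrable.
have : \int[unif]_x (1 + f x) = 1 + (F 1 - F 0) by rewrite /Rintegral f1E.
rewrite RintegralD//; last exact: finite_measure_integrable_cst.
rewrite Rintegral_probability_cst; exact: addrI.
Qed.

Lemma sinD2piz (k : int) : sin (2 * pi * k%:~R) = 0 :> R.
Proof.
have H n : sin (2 * pi * n%:R) = 0 :> R.
  by elim: n => [|n ih]; [rewrite mulr0 sin0|rewrite -[n.+1]addn1 natrD mulrDr mulr1 sinD ih mulr_natl sin2pi; ring].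
by case: k => n; [exact: H|rewrite NegzE mulrNz mulrN sinN H oppr0].
Qed.

Lemma cosD2piz (k : int) : cos (2 * pi * k%:~R) = 1 :> R.
Proof.
have H n : cos (2 * pi * n%:R) = 1 :> R.
  by elim: n => [|n ih]; [rewrite mulr0 cos0|rewrite -[n.+1]addn1 natrD mulrDr mulr1 cosD ih mulr_natl cos2pi sin2pi; ring].
by case: k => n; [exact: H|rewrite NegzE mulrNz mulrN cosN H].
Qed.

Lemma int_cos_uniform (k : int) :
  \int[unif]_x cos (2 * pi * k%:~R * x) = (k == 0)%:R.
Proof.
have [->|k0] := eqVneq k 0.
  under eq_Rintegral do rewrite mulr0 mul0r cos0.
  exact: Rintegral_probability_cst.
have c0 : 2 * pi * k%:~R != 0 :> R by rewrite mulf_neq0 ?intr_eq0// gt_eqF// mulr_gt0// pi_gt0.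
pose F x : R := (2 * pi * k%:~R)^-1 * sin (2 * pi * k%:~R * x).
transitivity (F 1 - F 0); [apply: Rintegral_uniform_FTC|].
- by move=> x; exact: norm_cos_le1.
- move=> x; apply: continuous_comp; last exact: continuous_cos.
  by apply: cvgM; [exact: cvg_cst|exact: cvg_id].
- move=> x; apply: is_derive_eq.
  by rewrite /GRing.scale/= mulr1 mulrCA mulVf ?mulr1.
- by rewrite /F mulr0 mulr1 sin0 sinD2piz subrr.
Qed.

Lemma int_sin_uniform (k : int) : \int[unif]_x sin (2 * pi * k%:~R * x) = 0.
Proof.
have [->|k0] := eqVneq k 0.
  under eq_Rintegral do rewrite mulr0 mul0r sin0.
  exact: Rintegral_probability_cst.
have c0 : 2 * pi * k%:~R != 0 :> R by rewrite mulf_neq0 ?intr_eq0// gt_eqF// mulr_gt0// pi_gt0.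
pose F x : R := - (2 * pi * k%:~R)^-1 * cos (2 * pi * k%:~R * x).
transitivity (F 1 - F 0); [apply: Rintegral_uniform_FTC|].
- by move=> x; exact: norm_sin_le1.
- move=> x; apply: continuous_comp; last exact: continuous_sin.
  by apply: cvgM; [exact: cvg_cst|exact: cvg_id].
- move=> x; apply: is_derive_eq.
  by rewrite /GRing.scale/= mulr1 mulNr mulNr mulrN opprK mulrCA mulVf ?mulr1.
- by rewrite /F mulr0 mulr1 cos0 cosD2piz subrr.
Qed.

End unit_interval.

(** * Orthogonality of integer frequencies on the cube *)

Section cube_frequencies.
Variable R : realType.
Local Notation unif := (uniform_prob (@ltr01 R)).

Lemma Rintegral_cubeS n (f : n.+1.-tuple R -> R) : measurable_fun setT f ->
  (forall x, `|f x| <= 1) ->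
  \int[cube_prob R n.+1]_x f x =
  \int[unif]_t \int[cube_prob R n]_y f [tuple of t :: y].
Proof.
move=> mf f1.
have mfc : measurable_fun setT (f \o @cons_pair R n).
  by apply: measurableT_comp => //; exact: measurable_cons_pair.
pose P : probability (measurableTypeR R * n.-tuple R)%type R := (unif \x cube_prob R n)%E.
have ifc := @bounded_integrable _ _ _ P _ mfc (fun x => f1 (cons_pair x)).
rewrite {1}/Rintegral (@integral_distribution _ _ _ _ _ _ (@cons_pair R n) (EFin \o f))//.
  rewrite -(fubini1 ifc) /Rintegral; congr fine; apply: eq_integral => t _.
  rewrite /fubini_F fineK//; apply: integrable_fin_num => //.
  apply: bounded_integrable => //.
  by apply: (measurableT_comp mf); exact: measurable_cons.
exact/measurable_EFinP.
Qed.

Definition phase n (m : 'I_n -> int) (y : n.-tuple R) : R :=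
  2 * pi * \sum_(i < n) (m i)%:~R * tnth y i.

Lemma measurable_phase n m : measurable_fun setT (@phase n m).
Proof.
apply: measurable_funM => //; apply: measurable_sum => i.
by apply: measurable_funM => //; exact: measurable_tnth.
Qed.

Lemma phase_cons n m t (y : n.-tuple R) :
  phase m [tuple of t :: y] = 2 * pi * (m ord0)%:~R * t + phase (fun i => m (lift ord0 i)) y.
Proof.
rewrite /phase big_ord_recl mulrDr mulrA tnth0; congr (_ + _ * _).
by apply: eq_bigr => i _; rewrite tnthS.
Qed.

Lemma measurable_cos_phase n m : measurable_fun setT (fun y => cos (@phase n m y)).
Proof.
apply: measurableT_comp; last exact: measurable_phase.
by apply: continuous_measurable_fun; exact: continuous_cos.
Qed.

Lemma measurable_sin_phase n m : measurable_fun setT (fun y => sin (@phase n m y)).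
Proof.
apply: measurableT_comp; last exact: measurable_phase.
by apply: continuous_measurable_fun; exact: continuous_sin.
Qed.

(** Induction on the dimension, splitting off the first coordinate. In both addition formulas the
    term with the inner sine vanishes, which leaves a one-dimensional integral times the inner
    cosine integral. *)
Lemma int_phase n (m : 'I_n -> int) :
  \int[cube_prob R n]_y cos (phase m y) = [forall i, m i == 0]%:R /\
  \int[cube_prob R n]_y sin (phase m y) = 0.
Proof.
elim: n m => [|n ih] m.
  have ph y : phase m y = 0 by rewrite /phase big_ord0 mulr0.
  split.
    under eq_Rintegral do rewrite ph cos0.
    rewrite Rintegral_probability_cst.
    by have -> : [forall i, m i == 0] by apply/forallP => -[].
  under eq_Rintegral do rewrite ph sin0.
  exact: Rintegral_probability_cst.
pose m' i := m (lift ord0 i); have [ihc ihs] := ih m'.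
have icos : (cube_prob R n).-integrable setT (EFin \o (fun y => cos (phase m' y))).
  by apply: bounded_integrable; [exact: measurable_cos_phase|move=> x; exact: norm_cos_le1].
have isin : (cube_prob R n).-integrable setT (EFin \o (fun y => sin (phase m' y))).
  by apply: bounded_integrable; [exact: measurable_sin_phase|move=> x; exact: norm_sin_le1].
have icst c f : (cube_prob R n).-integrable setT (EFin \o f) ->
  (cube_prob R n).-integrable setT (EFin \o (fun y => c * f y)).
  by move=> /(integrableZl measurableT c).
split; (rewrite Rintegral_cubeS; [|by [exact: measurable_cos_phase|exact: measurable_sin_phase]
  |by move=> x; rewrite ?norm_cos_le1 ?norm_sin_le1]).
- transitivity (\int[unif]_t (cos (2 * pi * (m ord0)%:~R * t) * [forall i, m' i == 0]%:R)).
    apply: eq_Rintegral => t _; under eq_Rintegral do rewrite phase_cons cosD.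
    rewrite RintegralB//; [|exact: icst..].
    by rewrite !RintegralZl// ihc ihs mulr0 subr0.
  rewrite RintegralZr//; last first.
    apply: bounded_integrable; last by move=> x; exact: norm_cos_le1.
    apply: measurableT_comp; last exact: measurable_funM.
    by apply: continuous_measurable_fun; exact: continuous_cos.
  rewrite int_cos_uniform -natrM mulnb; congr (nat_of_bool _)%:R.
  apply/andP/forallP => [[m0 /forallP m'0] i|H].
    by case: (unliftP ord0 i) => [j ->|->//]; exact: m'0.
  by split; [exact: H|apply/forallP => i; exact: H].
- transitivity (\int[unif]_t (sin (2 * pi * (m ord0)%:~R * t) * [forall i, m' i == 0]%:R)).
    apply: eq_Rintegral => t _; under eq_Rintegral do rewrite phase_cons sinD.
    rewrite RintegralD//; [|exact: icst..].
    by rewrite !RintegralZl// ihc ihs mulr0 addr0.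
  rewrite RintegralZr//; last first.
    apply: bounded_integrable; last by move=> x; exact: norm_sin_le1.
    apply: measurableT_comp; last exact: measurable_funM.
    by apply: continuous_measurable_fun; exact: continuous_sin.
  by rewrite int_sin_uniform mul0r.
Qed.

(** Allows identities that hold only for $0<y_i<1$ to be used for the cube. *)
Lemma cube_prob_coord n (i : 'I_n) :
  cube_prob R n (@tnth n R ^~ i @^-1` (~` `]0, 1[%classic)) = 0%E.
Proof.
elim: n i => [[]//|n ih] i.
have m01 : measurable (~` `]0, 1[%classic : set (measurableTypeR R)).
  by apply: measurableC; exact: measurable_itv.
have [->|[j ->]] : i = ord0 \/ exists j, i = lift ord0 j.
  by case: (unliftP ord0 i) => [j ->|->]; [right; exists j|left].
- rewrite [LHS]/= /distribution /pushforward.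
  rewrite (_ : _ @^-1` _ = (~` `]0, 1[%classic) `*` setT); last first.
    by apply/seteqP; split => -[t y] /=; rewrite tnth0 => //; case.
  by rewrite product_measure1E//= [X in (X * _)%E]uniform_setC_itvoo mul0e.
- rewrite [LHS]/= /distribution /pushforward.
  rewrite (_ : _ @^-1` _ = setT `*` (@tnth n R ^~ j @^-1` (~` `]0, 1[%classic))); last first.
    by apply/seteqP; split => -[t y] /=; rewrite tnthS => //; case.
  rewrite product_measure1E//= ?ih ?mule0//.
  have := @measurable_tnth _ R n j measurableT _ m01.
  by rewrite setTI.
Qed.

End cube_frequencies.

(** * Density and Parseval's identity on the cube *)

Section cube_parseval.
Variables (R : realType) (n : nat).

Local Notation nu := (cube_prob R n).

(** Row vectors supply the additive group that the sections on density and Parseval require of the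
    index type. *)
Definition freq (m : 'rV[int]_n) : n.-tuple R -> R := phase (m ord0).

Lemma freqD m1 m2 y : freq (m1 + m2) y = freq m1 y + freq m2 y.
Proof.
rewrite /freq /phase -mulrDr -big_split/=; congr (_ * _).
by apply: eq_bigr => i _; rewrite mxE rmorphD mulrDl.
Qed.

Lemma freq_delta (i : 'I_n) y : freq (delta_mx ord0 i) y = 2 * pi * tnth y i.
Proof.
rewrite /freq /phase (bigD1 i)//= big1 ?addr0; last first.
  by move=> j ji; rewrite mxE (negPf ji) andbF mul0r.
by rewrite mxE !eqxx mul1r.
Qed.

Lemma measurable_freq m : measurable_fun setT (freq m).
Proof. exact: measurable_phase. Qed.

Local Notation closure := (span_closure nu freq).
Local Notation in_alg := (in_algebra nu freq).

(** The squared difference of the two indicators is at most the indicator of the null set where the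
    coordinate leaves the open interval. *)
Lemma in_algebra_coord_ae (i : 'I_n) A B : in_alg A -> measurable B ->
  (forall y, 0 < tnth y i < 1 -> A y <-> B y) -> in_alg B.
Proof.
move=> [mA MA] mB AB; split => //.
apply: (closure_ae measurable_freq MA); first exact: measurable_indic.
pose N := @tnth n R ^~ i @^-1` (~` `]0, 1[%classic).
have mN : measurable N.
  have m01 : measurable (~` `]0, 1[%classic : set R).
    by apply: measurableC; exact: measurable_itv.
  have := @measurable_tnth _ R n i measurableT _ m01.
  by rewrite setTI.
apply/eqP; rewrite eq_le sqnorm_ge0 andbT.
apply: (@le_trans _ _ (\int[nu]_x (\1_N x)%:E)%E); last first.
  have N0 : nu N = 0%E := cube_prob_coord R i.
  by rewrite integral_indic// setIT /= N0.
apply: ge0_le_integral => //.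
- by move=> x _; rewrite lee_fin sqr_ge0.
- by apply: measurable_EFin_sqr; apply: measurable_funB; exact: measurable_indic.
- by apply/measurable_EFinP; exact: measurable_indic.
move=> x _; rewrite lee_fin !indicE.
have [xN|/negP xN] := boolP (x \in N).
  by case: (x \in A); case: (x \in B) => /=; lra.
have x01 : 0 < tnth x i < 1.
  by apply: contrapT => H; apply: xN; rewrite inE => x01; apply: H; move: x01; rewrite /= in_itv.
suff -> : (x \in A) = (x \in B) by rewrite subrr expr0n.
by apply/idP/idP; rewrite !inE => /AB; exact.
Qed.

Lemma in_algebra_coord_lt (i : 'I_n) a : in_alg [set y | tnth y i < a].
Proof.
have mfreq := measurable_freq.
have sa := sigma_algebra_in_algebra nu mfreq freqD.
have mA : measurable [set y : n.-tuple R | tnth y i < a].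
  rewrite (_ : [set y | _] = setT `&` @tnth n R ^~ i @^-1` `]-oo, a[%classic).
    by apply: measurable_tnth => //; exact: measurable_itv.
  by rewrite setTI; apply/seteqP; split => y /=; rewrite in_itv.
(* For [a] outside $(0,1)$ the half-space is almost everywhere empty or full. *)
have [a0|a0] := leP a 0.
  apply: (@in_algebra_coord_ae i set0) => //.
    by case: sa.
  by move=> y /andP[y0 _]; split => //= ya; lra.
have [a1|a1] := leP 1 a.
  apply: (@in_algebra_coord_ae i setT) => //.
    by rewrite -setC0; apply: in_algebraC => //; [exact: freqD|case: sa].
  by move=> y /andP[_ y1]; split => //= _; lra.
(* $h<1/2$ says $\cos(2\pi y_i-\pi a)>\cos(\pi a)$. The factor $1/4$ keeps [h] within $[0,1]$, and
   expanding the cosine of the difference exhibits [h] as a combination of functions in the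
   closure. *)
pose h (y : n.-tuple R) : R := 2^-1 - 4^-1 * (cos (pi * a) * cos (freq (delta_mx ord0 i) y)
  + sin (pi * a) * sin (freq (delta_mx ord0 i) y) - cos (pi * a)).
have hE y : h y = 2^-1 - 4^-1 * (cos (2 * pi * tnth y i - pi * a) - cos (pi * a)).
  by rewrite /h freq_delta cosB; congr (_ - _ * (_ - _)); ring.
have Mcst c : closure (fun=> c) := closure_cst nu mfreq freqD c.
have Mh : closure h.
  apply: (closureB mfreq) => //; apply: (closureZ mfreq).
  apply: (closureB mfreq) => //; apply: (closureD mfreq); apply: (closureZ mfreq).
    exact: (closure_cos nu mfreq freqD).
  exact: (closure_sin nu mfreq freqD).
have h01 y : 0 <= h y <= 1.
  rewrite hE.
  have := cos_le1 (2 * pi * tnth y i - pi * a); have := cos_geN1 (2 * pi * tnth y i - pi * a).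
  have := cos_le1 (pi * a); have := cos_geN1 (pi * a).
  by move=> *; apply/andP; split; lra.
apply: (@in_algebra_coord_ae i [set y | h y < 2^-1]) => //.
  exact: (closure_threshold mfreq freqD).
move=> y /andP[y0 y1] /=.
have pi0 := pi_gt0 R.
have -> : (h y < 2^-1) = (0 < sin (pi * tnth y i) * sin (pi * (a - tnth y i))).
  have E : cos (2 * pi * tnth y i - pi * a) - cos (pi * a) =
           2 * (sin (pi * tnth y i) * sin (pi * (a - tnth y i))).
    set s := pi * tnth y i; set r := pi * (a - tnth y i).
    have -> : 2 * pi * tnth y i - pi * a = s - r by rewrite /s /r; ring.
    have -> : pi * a = s + r by rewrite /s /r; ring.
    by rewrite cosB cosD; ring.
  rewrite hE E; apply/idP/idP; lra.
(* With $\sin(\pi y_i)>0$ the sign is that of $\sin(\pi(a-y_i))$; as $|a-y_i|<1$, this is positive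
   exactly when $y_i<a$. *)
have s0 : 0 < sin (pi * tnth y i).
  by apply: sin_gt0_pi; rewrite mulr_gt0//= gtr_pMr.
rewrite pmulr_rgt0//; split => [|ya]; last first.
  by apply: sin_gt0_pi; rewrite mulr_gt0 ?subr_gt0//= gtr_pMr//; lra.
apply: contraPT; rewrite -leNgt => ay; apply/negP; rewrite -leNgt.
rewrite -oppr_ge0 -sinN; apply: sin_ge0_pi.
by rewrite -mulrN opprB mulr_ge0 ?subr_ge0 ?(ltW pi0)//= ler_piMr ?(ltW pi0)//; lra.
Qed.

(** Preimages of Borel sets under the coordinates generate the measurable sets of tuples, and open
    left rays generate the Borel sets. The sets of reals whose preimage is good form a
    sigma-algebra, so the half-spaces suffice. *)
Lemma in_algebra_cube A : measurable A -> in_alg A.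
Proof.
have mfreq := measurable_freq.
have sa := sigma_algebra_in_algebra nu mfreq freqD.
apply: smallest_sub => //.
rewrite -bigcup_seq/=; apply: bigcup_sub => i _ _ [B mB <-].
have saR : sigma_algebra setT [set B | in_alg (@tnth n R ^~ i @^-1` B)].
  have := sigma_algebra_image (@tnth n R ^~ i) sa.
  by congr (sigma_algebra _ _); apply/funext => C; rewrite /image_set_system/= setTI.
rewrite setTI.
suff : (@ocitv R).-sigma.-measurable `<=` [set B | in_alg (@tnth n R ^~ i @^-1` B)] by apply.
rewrite (RGenInftyO.measurableE R); apply: smallest_sub => // _ [a ->] /=.
exact: in_algebra_coord_lt.
Qed.

Lemma cube_parseval u v : L2 nu u -> L2 nu v ->
  (\esum_(m in [set: 'rV[int]_n]) (coef2 nu freq u v m)%:E = sqnorm nu u + sqnorm nu v)%E.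
Proof.
move=> u2 v2; apply: parseval => //.
- exact: measurable_freq.
- exact: freqD.
- move=> m; have [-> _] := int_phase R (m ord0); congr (nat_of_bool _)%:R.
  apply/forallP/eqP => [m0|->]; last by move=> i; rewrite mxE.
  by apply/rowP => i; rewrite mxE; apply/eqP.
- by move=> m; have [_ ->] := int_phase R (m ord0).
- move=> f f2; apply: closure_L2 => //; [exact: measurable_freq|exact: in_algebra_cube].
Qed.

End cube_parseval.

(** * Sums over a forest *)

Section tree.
Variable R : realType.

Lemma esum_prod_fin (T : choiceType) (J : finType) (F : T * J -> \bar R) :
  (forall p, 0 <= F p)%E ->
  (\esum_(p in [set: T * J]) F p = \esum_(t in [set: T]) \sum_(j : J) F (t, j))%E.
Proof.
move=> F0; have -> : [set: T * J] = [set: T] `*`` (fun=> [set: J]).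
  by apply/seteqP; split.
transitivity (\esum_(k in [set: T] `*`` (fun=> [set: J])) F (k.1, k.2))%E.
  by apply: eq_esum => -[].
rewrite -(esum_esum (a := fun t j => F (t, j)))//; apply: eq_esum => t _.
rewrite esum_fset//; last exact: finite_finset.
rewrite [RHS]fsbig_seq ?index_enum_uniq//; congr (\big[_/_]_(_ \in _) _).
by apply/seteqP; split => j // _ /=; exact: mem_index_enum.
Qed.

Lemma esum_inj_le (T T' : choiceType) (f : T -> T') (F : T' -> \bar R) :
  injective f -> (forall t, 0 <= F t)%E ->
  (\esum_(t in [set: T]) F (f t) <= \esum_(t in [set: T']) F t)%E.
Proof.
move=> finj F0; rewrite -(esum_image [set: T] f F); last by move=> x y _ _; exact: finj.
rewrite esum_mkcond; apply: le_esum => t _.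
by case: ifP.
Qed.

(** The children of $a$ are $3a+1$, $3a+2$, $3a+3$. Division by 3 recovers the parent, whence
    injectivity; the successor makes a child larger than its parent, which excludes cycles. *)
Definition child (q : nat * 'I_3) : nat := (3 * q.1 + q.2).+1.

Lemma child_inj : injective child.
Proof.
move=> [a i] [b j] []; rewrite /= => E.
have ha : a = b.
  have := congr1 (fun x => x %/ 3)%N E; rewrite ![(3 * _)%N]mulnC !divnMDl//.
  by rewrite !divn_small// !addn0.
by subst b; congr (_, _); apply/val_inj => /=; exact: addnI E.
Qed.

Lemma child_gt q : (q.1 < child q)%N.
Proof. by rewrite /child ltnS (leq_trans _ (leq_addr _ _))// leq_pmull. Qed.

(* |z|^2 <= 2|z + w|^2 + 2|w|^2 with z at a vertex and w at its three children:
   each vertex pays three times as a parent and only once as a child. *)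
Lemma tree_bound (Z1 Z2 : nat -> R) (W : nat * 'I_3 -> R) (n1 n2 : R) :
  (forall a, 0 <= Z1 a) -> (forall a, 0 <= Z2 a) -> (forall q, 0 <= W q) ->
  (forall q, W q <= 2 * (Z1 q.1 + Z2 (child q))) ->
  (forall q, Z1 q.1 <= 2 * (W q + Z2 (child q))) ->
  (\esum_(a in [set: nat]) (Z1 a)%:E = n1%:E)%E ->
  (\esum_(a in [set: nat]) (Z2 a)%:E = n2%:E)%E ->
  exists s, [/\ (\esum_(q in [set: nat * 'I_3]) (W q)%:E = s%:E)%E,
    s <= 2 * (3 * n1 + n2) & 3 * n1 <= 2 * (s + n2)].
Proof.
move=> Z10 Z20 W0 WZ ZW E1 E2.
have Z10' a : (0 <= (Z1 a)%:E)%E by rewrite lee_fin.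
have Z20' a : (0 <= (Z2 a)%:E)%E by rewrite lee_fin.
have W0' q : (0 <= (W q)%:E)%E by rewrite lee_fin.
pose S := (\esum_(q in [set: nat * 'I_3]) (W q)%:E)%E.
pose C := (\esum_(q in [set: nat * 'I_3]) (Z2 (child q))%:E)%E.
pose P := (\esum_(q in [set: nat * 'I_3]) (Z1 q.1)%:E)%E.
have PE : P = (3 * n1)%:E.
  rewrite /P esum_prod_fin//=.
  transitivity (\esum_(t in [set: nat]) ((Z1 t)%:E + (Z1 t)%:E + (Z1 t)%:E))%E.
    by apply: eq_esum => t _; rewrite !big_ord_recl big_ord0 adde0 addeA.
  rewrite !esumD// ?E1; last by move=> *; rewrite adde_ge0.
  by rewrite -!EFinD; congr _%:E; ring.
have C_le : (C <= n2%:E)%E by rewrite -E2; exact: (esum_inj_le child_inj).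
have C0 : (0 <= C)%E by apply: esum_ge0.
have S0 : (0 <= S)%E by apply: esum_ge0.
(* The factor 2 is written as a repeated sum, so that additivity of [esum] is enough. *)
have S_le : (S <= (P + C) + (P + C))%E.
  rewrite /P /C -!esumD//; do ?by move=> *; rewrite ?adde_ge0.
  by apply: le_esum => q _; rewrite -!EFinD lee_fin (le_trans (WZ q))//; lra.
have P_le : (P <= (S + C) + (S + C))%E.
  rewrite /S /C -!esumD//; do ?by move=> *; rewrite ?adde_ge0.
  by apply: le_esum => q _; rewrite -!EFinD lee_fin (le_trans (ZW q))//; lra.
(* The bound by [n2] makes [C] finite, and the bound by [P] and [C] then makes [S] finite; from here
   on the inequalities are between reals. *)
move: S_le P_le; rewrite -/S PE; move: C C_le C0 => [c| |]//; rewrite lee_fin => c_le c0.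
move: S S0 => [s| |]// s0; rewrite -!EFinD !lee_fin => S_le P_le.
by exists s; split => //; lra.
Qed.

End tree.

(** * The segment and the face *)

Lemma rV_int_enum n : (0 < n)%N ->
  exists e : nat -> 'rV[int]_n, set_bij [set: nat] [set: 'rV[int]_n] e.
Proof.
move=> n0; have inf : infinite_set [set: 'rV[int]_n].
  (* The absolute value of the first entry maps the row vectors onto the natural numbers. *)
  move=> /(@finite_image _ _ _ (fun m : 'rV[int]_n => `|m ord0 (Ordinal n0)|%N)).
  rewrite (_ : _ @` _ = setT); first exact: infinite_nat.
  by apply/seteqP; split => // k _; exists (const_mx k%:Z) => //; rewrite mxE.
have /card_set_bijP[f] := eq_card_nat (countableP _) inf.
rewrite setTT_bijective => -[e fK eK].
by exists e; rewrite setTT_bijective; exists f.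
Qed.

Section arc_plus_face.
Variables (R : realType) (n : nat).
Local Notation nu1 := (cube_prob R 1).
Local Notation nun := (cube_prob R n).
Implicit Types (u v h : n.+1.-tuple R -> R) (g : n.+1.-tuple R -> \bar R).

(** Parametrized by the one-dimensional cube, so that the segment and the face fall under the same
    results on [cube_prob]. *)
Definition seg (y : 1.-tuple R) : n.+1.-tuple R := seg_pt n.+1 (tnth y ord0).
Definition face (y : n.-tuple R) : n.+1.-tuple R := @face_pt R n.+1 y.

Lemma measurable_seg : measurable_fun setT seg.
Proof.
apply/measurable_fun_tnthP => i.
rewrite (_ : _ \o _ = fun y => if val i == 0%N then tnth y ord0 else 0); last first.
  by apply/funext => y /=; rewrite tnth_mktuple.
by case: (val i == 0%N) => //; exact: measurable_tnth.
Qed.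

Lemma tnth_face0 y : tnth (face y) ord0 = 0.
Proof. by rewrite tnth_mktuple. Qed.

Lemma tnth_faceS y i : tnth (face y) (lift ord0 i) = tnth y i.
Proof. by rewrite tnth_mktuple /= (tnth_nth 0). Qed.

Lemma measurable_face : measurable_fun setT face.
Proof.
apply/measurable_fun_tnthP => i; case: (unliftP ord0 i) => [j ->|->].
  rewrite (_ : _ \o _ = fun y => tnth y j); first exact: measurable_tnth.
  by apply/funext => y /=; rewrite tnth_faceS.
rewrite (_ : _ \o _ = fun=> 0)//.
by apply/funext => y /=; rewrite tnth_face0.
Qed.

Lemma mu_nnintE g : measurable_fun setT g -> (forall x, 0 <= g x)%E ->
  mu_nnint g = (\int[nu1]_y g (seg y) + \int[nun]_y g (face y))%E.
Proof.
move=> mg g0; rewrite -!cube_intE//.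
- by apply: measurableT_comp => //; exact: measurable_face.
- by apply: measurableT_comp => //; exact: measurable_seg.
Qed.

Lemma L2mu_norm2E u v : measurable_fun setT u -> measurable_fun setT v ->
  L2mu_norm2 u v = ((sqnorm nu1 (u \o seg) + sqnorm nu1 (v \o seg))
                  + (sqnorm nun (u \o face) + sqnorm nun (v \o face)))%E.
Proof.
move=> mu mv; have [ms mf] := (measurable_seg, measurable_face).
rewrite /L2mu_norm2 mu_nnintE; last 2 first.
- by apply/measurable_EFinP/measurable_funD; exact: measurable_funX.
- by move=> x; rewrite lee_fin addr_ge0 ?sqr_ge0.
by rewrite /sqnorm -!ge0_integralD//;
  do ?[by move=> x _; rewrite lee_fin sqr_ge0 | exact/measurable_EFin_sqr/measurableT_comp].
Qed.

(** [mu_int] first separates positive and negative parts, then segment and face. Integrability makes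
    all four integrals finite, so they can be regrouped without meeting the default value of
    [fine]. *)
Lemma mu_intE h : measurable_fun setT h ->
  nu1.-integrable setT (EFin \o (h \o seg)) -> nun.-integrable setT (EFin \o (h \o face)) ->
  mu_int h = \int[nu1]_y h (seg y) + \int[nun]_y h (face y).
Proof.
move=> mh is_ if_; rewrite /mu_int !mu_nnintE; last 4 first.
- by apply/measurable_EFinP/measurable_maxr => //; exact: measurable_funN.
- by move=> x; rewrite lee_fin le_max lexx orbT.
- by apply/measurable_EFinP/measurable_maxr.
- by move=> x; rewrite lee_fin le_max lexx orbT.
have posE d (T : measurableType d) (P : probability T R) (f : T -> R) :
    P.-integrable setT (EFin \o f) ->
  exists a b : R, [/\ (\int[P]_x (Num.max (f x) 0)%:E = a%:E)%E,
    (\int[P]_x (Num.max (- f x) 0)%:E = b%:E)%E & \int[P]_x f x = a - b].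
  move=> fi; have [fp fn] := (integrable_funepos measurableT fi, integrable_funeneg measurableT fi).
  have pE : (fun x => (Num.max (f x) 0)%:E) = (EFin \o f)^\+%E.
    by apply/funext => x; rewrite funeposE /= EFin_max.
  have nE : (fun x => (Num.max (- f x) 0)%:E) = (EFin \o f)^\-%E.
    by apply/funext => x; rewrite funenegE /= EFin_max.
  exists (fine (\int[P]_x (EFin \o f)^\+ x)%E), (fine (\int[P]_x (EFin \o f)^\- x)%E).
  rewrite !fineK ?pE ?nE; [|exact: integrable_fin_num..]; split => //.
  by rewrite /Rintegral integralE fineB//; exact: integrable_fin_num.
have [a [b [-> -> ->]]] := posE _ _ _ _ is_.
have [a' [b' [-> -> ->]]] := posE _ _ _ _ if_.
by rewrite -!EFinD /=; ring.
Qed.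

Definition frequency (k : 'rV[int]_1) (m : 'rV[int]_n) : n.+1.-tuple R :=
  [tuple of (k ord0 ord0)%:~R :: [tuple (m ord0 i)%:~R | i < n]].

Lemma frequency_inj k m k' m' : frequency k m = frequency k' m' -> k = k' /\ m = m'.
Proof.
move=> E; split; apply/rowP => i.
  have := congr1 (fun t => tnth t ord0) E; rewrite !tnth0 (ord1 i); exact: intr_inj.
have := congr1 (fun t => tnth t (lift ord0 i)) E.
rewrite !tnthS !tnth_mktuple; exact: intr_inj.
Qed.

(** The segment sees only [k] and the face only [m]. This is why a coefficient at a pair of indices
    is a sum of one coefficient from each piece. *)
Lemma dot_frequency_seg k m y : 2 * pi * dotR (frequency k m) (seg y) = freq k y.
Proof.
rewrite /dotR /freq /phase big_ord_recl big1 ?addr0; last first.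
  by move=> i _; rewrite [X in _ * X]tnth_mktuple mulr0.
by rewrite tnth0 tnth_mktuple /= big_ord_recl big_ord0 addr0.
Qed.

Lemma dot_frequency_face k m y : 2 * pi * dotR (frequency k m) (face y) = freq m y.
Proof.
rewrite /dotR /freq /phase big_ord_recl tnth_face0 mulr0 add0r; congr (_ * _).
by apply: eq_bigr => i _; rewrite tnth_faceS tnthS tnth_mktuple.
Qed.

End arc_plus_face.

(** * The frame inequalities *)

Section frame.
Variables (R : realType) (n : nat).
Local Notation nu1 := (cube_prob R 1).
Local Notation nun := (cube_prob R n).
Local Notation sg := (@seg R n).
Local Notation fc := (@face R n).
Implicit Types u v : n.+1.-tuple R -> R.

Lemma L2_freq_integrable k (P := cube_prob R k) (m : 'rV[int]_k) f g : L2 P f -> L2 P g ->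
  P.-integrable setT (EFin \o (fun y => f y * cos (freq m y) + g y * sin (freq m y))) /\
  P.-integrable setT (EFin \o (fun y => f y * cos (freq m y) - g y * sin (freq m y))).
Proof.
move=> f2 g2; have ic := integrable_mul f2 (L2_cos P (@measurable_freq R k) m).
have isn := integrable_mul g2 (L2_sin P (@measurable_freq R k) m).
by split; [exact: (integrableD measurableT ic isn)|exact: (integrableB measurableT ic isn)].
Qed.

Lemma measurable_dotR (lam : n.+1.-tuple R) : measurable_fun setT (dotR lam).
Proof.
apply: measurable_sum => i.
by apply: measurable_funM => //; exact: measurable_tnth.
Qed.

Lemma fourier_coef2E u v k (m : 'rV[int]_n) :
  measurable_fun setT u -> measurable_fun setT v ->
  L2 nu1 (u \o sg) -> L2 nu1 (v \o sg) ->
  L2 nun (u \o fc) -> L2 nun (v \o fc) ->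
  fourier_coef2 u v (frequency R k m) =
    (coef_re nu1 (@freq R 1) (u \o sg) (v \o sg) k +
     coef_re nun (@freq R n) (u \o fc) (v \o fc) m) ^+ 2 +
    (coef_im nu1 (@freq R 1) (u \o sg) (v \o sg) k +
     coef_im nun (@freq R n) (u \o fc) (v \o fc) m) ^+ 2.
Proof.
move=> mu mv us vs uf vf.
have mth : measurable_fun setT (fun x => 2 * pi * dotR (frequency R k m) x).
  by apply: measurable_funM => //; exact: measurable_dotR.
have mc : measurable_fun setT (fun x => cos (2 * pi * dotR (frequency R k m) x)).
  by apply: measurableT_comp mth; apply: continuous_measurable_fun; exact: continuous_cos.
have ms : measurable_fun setT (fun x => sin (2 * pi * dotR (frequency R k m) x)).
  by apply: measurableT_comp mth; apply: continuous_measurable_fun; exact: continuous_sin.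
rewrite /fourier_coef2 !mu_intE.
- congr ((_ + _) ^+ 2 + (_ + _) ^+ 2); apply: eq_Rintegral => y _ /=;
    by rewrite ?dot_frequency_seg ?dot_frequency_face.
- by apply: measurable_funB; exact: measurable_funM.
- rewrite (_ : _ \o _ = EFin \o (fun y => v (sg y) * cos (freq k y) - u (sg y) * sin (freq k y))).
    exact: (L2_freq_integrable k vs us).2.
  by apply/funext => y /=; rewrite dot_frequency_seg.
- rewrite (_ : _ \o _ = EFin \o (fun y => v (fc y) * cos (freq m y) - u (fc y) * sin (freq m y))).
    exact: (L2_freq_integrable m vf uf).2.
  by apply/funext => y /=; rewrite dot_frequency_face.
- by apply: measurable_funD; exact: measurable_funM.
- rewrite (_ : _ \o _ = EFin \o (fun y => u (sg y) * cos (freq k y) + v (sg y) * sin (freq k y))).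
    exact: (L2_freq_integrable k us vs).1.
  by apply/funext => y /=; rewrite dot_frequency_seg.
- rewrite (_ : _ \o _ = EFin \o (fun y => u (fc y) * cos (freq m y) + v (fc y) * sin (freq m y))).
    exact: (L2_freq_integrable m uf vf).1.
  by apply/funext => y /=; rewrite dot_frequency_face.
Qed.

(** A pair (segment index, face index). The boolean tells on which side the parent lies: the face
    for [true], the segment for [false]. *)
Definition edge (p : nat * 'I_3 * bool) : nat * nat :=
  if p.2 then (child p.1, p.1.1) else (p.1.1, child p.1).

(** For equal orientations this is [child_inj]. For opposite ones each parent would be the child of
    the other, contradicting [child_gt]. *)
Lemma edge_inj : injective edge.
Proof.
move=> [q b] [q' b'] E.
have := congr1 fst E; have := congr1 snd E; rewrite /edge /=.
have lt := child_gt q; have lt' := child_gt q'.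
case: b b' {E} => [] [] /= E1 E2.
- by rewrite (child_inj E2).
- by move: lt; rewrite E1 E2 => /(ltn_trans lt'); rewrite ltnn.
- by move: lt; rewrite E1 E2 => /(ltn_trans lt'); rewrite ltnn.
- by rewrite (child_inj E1).
Qed.

Lemma sqnorm_fin d (T : measurableType d) (P : probability T R) f : L2 P f ->
  exists2 a, sqnorm P f = a%:E & 0 <= a.
Proof.
move=> f2; exists (ip P f f); first exact: sqnormE.
by rewrite -lee_fin -sqnormE// sqnorm_ge0.
Qed.

Lemma frame_edges (e1 : nat -> 'rV[int]_1) (e2 : nat -> 'rV[int]_n) :
  set_bij [set: nat] [set: 'rV[int]_1] e1 -> set_bij [set: nat] [set: 'rV[int]_n] e2 ->
  is_fourier_frame_mu (range (fun p => frequency R (e1 (edge p).1) (e2 (edge p).2))).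
Proof.
move=> be1 be2; split; first exact: (card_le_trans (card_image_le _ _) (countableP _)).
(* Let $N_1,N_2$ be the squared norms on the two pieces and $s_1,s_2$ the edge sums of the two
   orientations. Adding $3N_1\le 2(s_1+N_2)$ and $3N_2\le 2(s_2+N_1)$ gives $s_1+s_2\ge
   (N_1+N_2)/2$; the upper bounds add up to $8(N_1+N_2)$, which is within 12. *)
exists 2^-1, 12; split => //; split => // u v [mu [mv uv]].
(* Distinct edges give distinct frequencies, so the sum over the range is a sum over edges. *)
rewrite esum_image; last first.
  move=> p q _ _ /frequency_inj[E1 E2]; apply: edge_inj.
  rewrite [edge p]surjective_pairing [edge q]surjective_pairing.
  case: be1 be2 => _ inj1 _ [_ inj2 _].
  by congr (_, _); [apply: inj1|apply: inj2]; rewrite ?inE.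
have [ms mf] := (@measurable_seg R n, @measurable_face R n).
rewrite -/(L2mu_norm2 u v) L2mu_norm2E// in uv *.
have fin4 (a b c d : \bar R) : (0 <= a -> 0 <= b -> 0 <= c -> 0 <= d ->
    (a + b) + (c + d) < +oo -> [/\ a < +oo, b < +oo, c < +oo & d < +oo])%E.
  by case: a => [a| |]; case: b => [b| |]; case: c => [c| |]; case: d => [d| |];
    rewrite ?ltry //=; split; rewrite ?ltry.
have [us vs uf vf] := fin4 _ _ _ _ (sqnorm_ge0 _ _) (sqnorm_ge0 _ _) (sqnorm_ge0 _ _) (sqnorm_ge0 _ _) uv.
have {us}us : L2 nu1 (u \o sg) by split => //; exact: measurableT_comp.
have {vs}vs : L2 nu1 (v \o sg) by split => //; exact: measurableT_comp.
have {uf}uf : L2 nun (u \o fc) by split => //; exact: measurableT_comp.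
have {vf}vf : L2 nun (v \o fc) by split => //; exact: measurableT_comp.
pose x1 a := coef_re nu1 (@freq R 1) (u \o sg) (v \o sg) (e1 a).
pose y1 a := coef_im nu1 (@freq R 1) (u \o sg) (v \o sg) (e1 a).
pose x2 b := coef_re nun (@freq R n) (u \o fc) (v \o fc) (e2 b).
pose y2 b := coef_im nun (@freq R n) (u \o fc) (v \o fc) (e2 b).
pose Z1 a := x1 a ^+ 2 + y1 a ^+ 2.
pose Z2 b := x2 b ^+ 2 + y2 b ^+ 2.
pose W (p : nat * 'I_3 * bool) :=
  (x1 (edge p).1 + x2 (edge p).2) ^+ 2 + (y1 (edge p).1 + y2 (edge p).2) ^+ 2.
have Z10 a : 0 <= Z1 a by rewrite addr_ge0 ?sqr_ge0.
have Z20 a : 0 <= Z2 a by rewrite addr_ge0 ?sqr_ge0.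
have W0 p : 0 <= W p by rewrite addr_ge0 ?sqr_ge0.
have [a1 us1 a10] := sqnorm_fin us; have [b1 vs1 b10] := sqnorm_fin vs.
have [a2 uf1 a20] := sqnorm_fin uf; have [b2 vf1 b20] := sqnorm_fin vf.
have E1 : (\esum_(a in [set: nat]) (Z1 a)%:E = (a1 + b1)%:E)%E.
  rewrite EFinD -us1 -vs1 -(cube_parseval us vs).
  by rewrite (reindex_esum _ _ _ _ be1).
have E2 : (\esum_(a in [set: nat]) (Z2 a)%:E = (a2 + b2)%:E)%E.
  rewrite EFinD -uf1 -vf1 -(cube_parseval uf vf).
  by rewrite (reindex_esum _ _ _ _ be2).
have [||s1 [S1 s1le s1ge]] := tree_bound Z10 Z20 (fun q => W0 (q, false)) _ _ E1 E2.
- move=> q; rewrite /W /Z1 /Z2 /=.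
  have := sqr_ge0 (x1 q.1 - x2 (child q)); have := sqr_ge0 (y1 q.1 - y2 (child q)); nra.
(* The identity behind the hint is $2(x_1+x_2)^2+2x_2^2-x_1^2=(x_1+2x_2)^2$. *)
- move=> q; rewrite /W /Z1 /Z2 /=.
  have := sqr_ge0 (x1 q.1 + 2 * x2 (child q)); have := sqr_ge0 (y1 q.1 + 2 * y2 (child q)); nra.
(* The same bound with the roles of segment and face exchanged, for the edges whose parent lies on
   the face side. *)
have [||s2 [S2 s2le s2ge]] := tree_bound Z20 Z10 (fun q => W0 (q, true)) _ _ E2 E1.
- move=> q; rewrite /W /Z1 /Z2 /=.
  have := sqr_ge0 (x2 q.1 - x1 (child q)); have := sqr_ge0 (y2 q.1 - y1 (child q)); nra.
- move=> q; rewrite /W /Z1 /Z2 /=.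
  have := sqr_ge0 (x2 q.1 + 2 * x1 (child q)); have := sqr_ge0 (y2 q.1 + 2 * y1 (child q)); nra.
have -> : (\esum_(p in [set: nat * 'I_3 * bool])
    (fourier_coef2 u v (frequency R (e1 (edge p).1) (e2 (edge p).2)))%:E = (s1 + s2)%:E)%E.
  transitivity (\esum_(p in [set: nat * 'I_3 * bool]) (W p)%:E)%E.
    by apply: eq_esum => p _; rewrite fourier_coef2E.
  rewrite esum_prod_fin; last by move=> p; rewrite lee_fin.
  under eq_esum do rewrite big_bool.
  by rewrite esumD ?S1 ?S2 -?EFinD 1?addrC// => q _; rewrite lee_fin.
by rewrite us1 vs1 uf1 vf1 -!EFinD -!EFinM !lee_fin; split; lra.
Qed.

End frame.

Theorem theorem1p1 (R : realType) (d : nat) (hd : (3 <= d)%N) :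
  exists Lam : set (d.-tuple R), is_fourier_frame_mu Lam.
Proof.
case: d hd => [//|n] hn.
have [e1 be1] := rV_int_enum (ltn0Sn 0).
have [e2 be2] := rV_int_enum (ltnW hn : (0 < n)%N).
by eexists; exact: frame_edges be1 be2.
Qed.
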